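(* Let $A,C\in\mathbb{R}^{n\times n}$, $B,D\in\mathbb{R}^{n\times m}$, $Q\in\mathbb{S}^n$ with $Q\geq 0$, and $R\in\mathbb{S}^m$ with $R>0$. Assume that the system $[A,B;C,D]$ is $L^2$-stabilizable. For $P\in\mathbb{S}^n_+$ define $$\mathcal R(P):=A^{\mathrm T}P+PA+C^{\mathrm T}PC+Q-(B^{\mathrm T}P+D^{\mathrm T}PC)^{\mathrm T}(R+D^{\mathrm T}PD)^{-1}(B^{\mathrm T}P+D^{\mathrm T}PC).$$ Then for any positive semidefinite matrix $P\in\mathbb{S}^n_+$ satisfying $\mathcal R(P)\geq 0$, we have $$P\leq P_\infty,$$ where $P_\infty\in\mathbb{S}^n_+$ is the unique static stabilizing solution of the algebraic Riccati equation $\mathcal R(P_\infty)=0$.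
   Context: $\mathbb{S}^n$ is the space of real symmetric $n\times n$ matrices, $\mathbb{S}^n_+$ the subset of positive semidefinite ones; $M\geq N$ (resp. $M>N$) means $M-N$ is positive semidefinite (resp. positive definite). $W$ is a one-dimensional standard Brownian motion. For $A',C'\in\mathbb{R}^{n\times n}$, the system $[A';C']$ is $L^2$-stable if for every $x\in\mathbb{R}^n$ the solution of $dX(s)=A'X(s)ds+C'X(s)dW(s)$, $s\geq0$, $X(0)=x$, satisfies $\mathbb E\int_0^\infty|X(s)|^2ds<\infty$. The system $[A,B;C,D]$ is $L^2$-stabilizable if there is $\Theta\in\mathbb{R}^{m\times n}$ such that $[A+B\Theta;C+D\Theta]$ is $L^2$-stable; such a $\Theta$ is called a stabilizer of $[A,B;C,D]$. A matrix $P\in\mathbb{S}^n$ is a static stabilizing solution of the algebraic Riccati equation if $\mathcal R(P)=0$ (with the same formula for $\mathcal R$) and $-(R+D^{\mathrm T}PD)^{-1}(B^{\mathrm T}P+D^{\mathrm T}PC)$ is a stabilizer of $[A,B;C,D]$. It is known that if $Q\geq0$, $R>0$ and $[A,B;C,D]$ is $L^2$-stabilizable, then there is a unique static stabilizing solution $P_\infty$, and it lies in $\mathbb{S}^n_+$. *)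

(* Defs.v *)
From HB Require Import structures.
From mathcomp Require Import all_boot all_order all_algebra.
From mathcomp Require Import all_classical all_reals all_analysis.

Set Implicit Arguments.
Unset Strict Implicit.
Unset Printing Implicit Defensive.

Import Order.TTheory GRing.Theory Num.Theory.
Import numFieldNormedType.Exports.

Local Open Scope classical_set_scope.
Local Open Scope ring_scope.

Definition psdmx (R : realType) (n : nat) (M : 'M[R]_n) : Prop :=
  M^T = M /\ forall x : 'cV[R]_n, 0 <= (x^T *m M *m x) 0 0.

Definition pdmx (R : realType) (n : nat) (M : 'M[R]_n) : Prop :=
  M^T = M /\ forall x : 'cV[R]_n, x != 0 -> 0 < (x^T *m M *m x) 0 0.

Definition loewner_le (R : realType) (n : nat) (M N : 'M[R]_n) : Prop :=
  psdmx (N - M).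

Section StochasticCalculus.
Context {R : realType} {d : measure_display} {Omega : measurableType d}.
Context (P : probability Omega R) (F : R -> set (set Omega)).

Local Notation mu := (@lebesgue_measure R).

Definition measurable_wrt (G : set (set Omega)) (f : Omega -> R) : Prop :=
  forall B : set R, measurable B -> G (f @^-1` B).

(* Time is [0, +oo[: values of filtrations and processes at negative times
   are never used. *)
Record complete_filtration : Prop := {
  filtration_sigma : forall t : R, 0 <= t -> sigma_algebra setT (F t) ;
  filtration_sub : forall t : R, 0 <= t -> F t `<=` measurable ;
  filtration_homo : forall s t : R, 0 <= s -> s <= t -> F s `<=` F t ;
  filtration_null : forall A, measurable A -> P A = 0%E -> F 0 A }.

Definition adapted (H : R -> Omega -> R) : Prop :=
  forall t : R, 0 <= t -> measurable_wrt (F t) (H t).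

Definition continuous_paths (H : R -> Omega -> R) : Prop :=
  {ae P, forall w, {within `[0, +oo[, continuous (fun t => H t w)}}.

Definition increment (W : R -> Omega -> R) (s t : R) (w : Omega) : R :=
  W t w - W s w.

(* The second parameter of [normal_prob] is the standard deviation. *)
Record brownian_motion (W : R -> Omega -> R) : Prop := {
  bm_adapted : adapted W ;
  bm_start : {ae P, forall w, W 0 w = 0} ;
  bm_indep : forall s t : R, 0 <= s -> s < t ->
    forall (A : set Omega) (B : set R), F s A -> measurable B ->
      P (A `&` increment W s t @^-1` B) =
      (P A * P (increment W s t @^-1` B))%E ;
  bm_normal : forall s t : R, 0 <= s -> s < t ->
    forall B : set R, measurable B ->
      P (increment W s t @^-1` B) = normal_prob 0 (Num.sqrt (t - s)) B ;
  bm_continuous : continuous_paths W }.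

Record simple_process := SimpleProcess {
  sp_size : nat ;
  sp_grid : nat -> R ;
  sp_coef : nat -> Omega -> R }.

Record is_simple_process (T : R) (phi : simple_process) : Prop := {
  sp_first : sp_grid phi 0 = 0 ;
  sp_last : sp_grid phi (sp_size phi) = T ;
  sp_homo : forall k, (k < sp_size phi)%N ->
    sp_grid phi k <= sp_grid phi k.+1 ;
  sp_adapted : forall k, (k < sp_size phi)%N ->
    measurable_wrt (F (sp_grid phi k)) (sp_coef phi k) ;
  sp_bounded : exists M : R, forall k w, (k < sp_size phi)%N ->
    `|sp_coef phi k w| <= M }.

Definition sp_fun (phi : simple_process) (s : R) (w : Omega) : R :=
  \sum_(k < sp_size phi)
    sp_coef phi k w * \1_(`]sp_grid phi k, sp_grid phi k.+1]) s.

Definition sp_integral (W : R -> Omega -> R) (phi : simple_process)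
    (w : Omega) : R :=
  \sum_(k < sp_size phi)
    sp_coef phi k w * increment W (sp_grid phi k) (sp_grid phi k.+1) w.

Record ito_integrand (T : R) (H : R -> Omega -> R) : Prop := {
  ito_measurable :
    measurable_fun (`[0, T]%classic `*` [set: Omega])
      (fun p : measurableTypeR R * Omega => H p.1 p.2) ;
  ito_adapted : adapted H ;
  ito_square_integrable :
    (\int[P]_w \int[mu]_(s in `[0%R, T]) ((H s w) ^+ 2)%:E < +oo)%E }.

(* [I] is (a version of) the Ito integral of [H] against [W] over [0, T]: the
   L^2(P)-limit of the integrals of simple processes that converge to [H] in
   L^2(dt x P). *)
Definition ito_integral (W : R -> Omega -> R) (T : R) (H : R -> Omega -> R)
    (I : Omega -> R) : Prop :=
  [/\ ito_integrand T H, measurable_fun setT I &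
    exists phi : nat -> simple_process,
    [/\ forall k, is_simple_process T (phi k),
      (fun k => \int[P]_w \int[mu]_(s in `[0%R, T])
         ((H s w - sp_fun (phi k) s w) ^+ 2)%:E)%E @ \oo --> 0%E &
      (fun k => \int[P]_w ((I w - sp_integral W (phi k) w) ^+ 2)%:E)%E
         @ \oo --> 0%E]].

(* dX = A X ds + C X dW, X(0) = x, in integral form and componentwise. *)
Record sde_solution (W : R -> Omega -> R) (n : nat) (A C : 'M[R]_n)
    (x : 'cV[R]_n) (X : R -> Omega -> 'cV[R]_n) : Prop := {
  sde_integrand : forall (T : R) i, 0 <= T ->
    ito_integrand T (fun s w => X s w i 0) ;
  sde_continuous : forall i, continuous_paths (fun s w => X s w i 0) ;
  sde_equation : forall (t : R) i, 0 <= t -> exists2 I : Omega -> R,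
    ito_integral W t (fun s w => (C *m X s w) i 0) I &
    {ae P, forall w,
      X t w i 0 =
      x i 0 + \int[mu]_(s in `[0, t]) ((A *m X s w) i 0) + I w} }.

(* The solution with initial value [x] exists and is unique up to
   indistinguishability, so that quantifying it existentially or universally
   gives the same notion. *)
Definition L2_stable (W : R -> Omega -> R) (n : nat) (A C : 'M[R]_n) : Prop :=
  forall x : 'cV[R]_n, exists2 X : R -> Omega -> 'cV[R]_n,
    sde_solution W A C x X &
    (\int[P]_w \int[mu]_(s in `[0%R, +oo[)
       (\sum_i (X s w i 0) ^+ 2)%:E < +oo)%E.

Definition stabilizer (W : R -> Omega -> R) (n m : nat)
    (A : 'M[R]_n) (B : 'M[R]_(n, m)) (C : 'M[R]_n) (D : 'M[R]_(n, m))
    (Theta : 'M[R]_(m, n)) : Prop :=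
  L2_stable W (A + B *m Theta) (C + D *m Theta).

Definition L2_stabilizable (W : R -> Omega -> R) (n m : nat)
    (A : 'M[R]_n) (B : 'M[R]_(n, m)) (C : 'M[R]_n) (D : 'M[R]_(n, m)) : Prop :=
  exists Theta : 'M[R]_(m, n), stabilizer W A B C D Theta.

End StochasticCalculus.

Section Riccati.
Context {R : realType} {n m : nat}.
Context (A : 'M[R]_n) (B : 'M[R]_(n, m)) (C : 'M[R]_n) (D : 'M[R]_(n, m)).
Context (Q : 'M[R]_n) (Rw : 'M[R]_m).

Definition riccati_weight (P : 'M[R]_n) : 'M[R]_m := Rw + D^T *m P *m D.

Definition riccati_cross (P : 'M[R]_n) : 'M[R]_(m, n) :=
  B^T *m P + D^T *m P *m C.

Definition riccati (P : 'M[R]_n) : 'M[R]_n :=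
  A^T *m P + P *m A + C^T *m P *m C + Q
  - (riccati_cross P)^T *m invmx (riccati_weight P) *m riccati_cross P.

(* [invmx] of a singular matrix is that matrix itself; the invertibility that
   the inverse in the Riccati equation presupposes is therefore explicit. *)
Record static_stabilizing {d : measure_display} {Omega : measurableType d}
    (Pr : probability Omega R) (F : R -> set (set Omega))
    (W : R -> Omega -> R) (P : 'M[R]_n) : Prop := {
  ss_sym : P^T = P ;
  ss_unit : riccati_weight P \in unitmx ;
  ss_riccati : riccati P = 0 ;
  ss_stabilizer : stabilizer Pr F W A B C D
    (- (invmx (riccati_weight P) *m riccati_cross P)) }.

End Riccati.

(* Main.v *)
From HB Require Import structures.
Require Import Defs.
From mathcomp Require Import all_boot all_order all_algebra.
From mathcomp Require Import all_classical all_reals all_analysis.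
From mathcomp Require Import measurable_realfun charge gauss_integral ring lra.

Set Implicit Arguments.
Unset Strict Implicit.
Unset Printing Implicit Defensive.

Import Order.TTheory GRing.Theory Num.Theory.
Import numFieldNormedType.Exports.

Local Open Scope classical_set_scope.
Local Open Scope ring_scope.

(** Write K(M) for the cross term B^T M + D^T M C and W(M) for the weight
    R + D^T M D, and let Theta = - W(Pinf)^-1 K(Pinf) be the feedback of the
    stabilizing solution.  Completing the square shows that, for every
    symmetric M with W(M) invertible, the cost operator of the feedback Theta,

      L(M) = Acl^T M + M Acl + Ccl^T M Ccl + Q + Theta^T R Theta,
      Acl = A + B Theta,  Ccl = C + D Theta,

    equals Riccati(M) + G^T W(M) G with G = Theta + W(M)^-1 K(M)
    ([feedback_cost_square]).  At Pinf both terms vanish; at P both are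
    positive semidefinite.  Subtracting, Delta = Pinf - P solves a Lyapunov
    equation Acl^T Delta + Delta Acl + Ccl^T Delta Ccl = - S with S >= 0
    ([riccati_difference]).

    It remains to see that Delta >= 0 ([stable_lyapunov]).  Let X solve
    dX = Acl X dt + Ccl X dW from x.  Its second moments satisfy a linear
    integral equation ([moment_equation]), which gives
    E[X(t)^T Delta X(t)] <= x^T Delta x for all t >= 0.  If the right-hand side
    were negative, E|X(t)|^2 would be bounded away from 0, against the
    finiteness of the integral of E|X|^2 over the half-line.

    The second moments are the stochastic part.  Instead of a pathwise Ito
    formula, the product rule [product_rule] is proved in expectation only:
    for U = u + int g + N and V = v + int h + N', with N and N' the Ito
    integrals of K and K',

      E[U(T) V(T)] = u v + int_0^T E[g V + U h + K K'] dt.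

    It needs two facts about the Ito integral, both inherited by L2 limits
    from elementary integrands: the isometry between integrals over possibly
    different horizons ([ito_isometry]) and the orthogonality of N(t) - N(s)
    to the past of s ([ito_martingale]).  The rest is Fubini, including the
    splitting of a square into two triangles ([integral_triangles]), which
    plays the role of the ordinary product rule for the two drifts.  The
    elementary case rests on the first two moments of Brownian increments,
    obtained from the normal density and from independence. *)

(** * Square-integrable functions *)

Section SquareIntegrable.
Context {d : measure_display} {T : measurableType d} {R : realType}.
Variable m : {measure set T -> \bar R}.
Implicit Types f g h : T -> R.

Definition sqint f : Prop :=
  measurable_fun setT f /\ (\int[m]_x ((f x) ^+ 2)%:E < +oo)%E.

Definition ip f g : R := \int[m]_x (f x * g x).

Lemma sqint_integrable_sqr f : sqint f ->
  m.-integrable setT (EFin \o (fun x => f x ^+ 2)).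
Proof.
move=> [mf lf]; apply/integrableP; split.
  by apply/measurable_EFinP; exact: measurable_funX.
by under eq_integral do rewrite /= ger0_norm ?sqr_ge0//.
Qed.

Lemma sqint_integrableM f g : sqint f -> sqint g ->
  m.-integrable setT (EFin \o (fun x => f x * g x)).
Proof.
move=> sf sg.
apply: (@le_integrable _ _ _ m setT _ _
  (fun x => (f x ^+ 2)%:E + (g x ^+ 2)%:E)%E) => //.
- by apply/measurable_EFinP/measurable_funM; [case: sf|case: sg].
- move=> x _ /=; rewrite lee_fin [leRHS]ger0_norm ?addr_ge0 ?sqr_ge0//.
  have := sqr_ge0 (`|f x| - `|g x|).
  rewrite sqrrB normrM !real_normK ?num_real//.
  have := sqr_ge0 (f x); have := sqr_ge0 (g x); nra.
- by apply: integrableD => //; exact: sqint_integrable_sqr.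
Qed.

Lemma sqintP f : measurable_fun setT f ->
  m.-integrable setT (EFin \o (fun x => f x ^+ 2)) -> sqint f.
Proof.
move=> mf /integrableP[_ h]; split => //; apply: le_lt_trans h.
by under [leRHS]eq_integral do rewrite /= ger0_norm ?sqr_ge0//.
Qed.

Lemma sqintD f g : sqint f -> sqint g -> sqint (fun x => f x + g x).
Proof.
move=> sf sg; apply: sqintP.
  by apply: measurable_funD; [case: sf|case: sg].
apply: (@eq_integrable _ _ _ _ _ measurableT
  (fun x => (f x ^+ 2)%:E + ((g x ^+ 2)%:E + 2%:E * (f x * g x)%:E))%E).
  by move=> x _ /=; rewrite -EFinM -!EFinD; congr EFin; ring.
apply: integrableD => //; first exact: sqint_integrable_sqr.
apply: integrableD => //; first exact: sqint_integrable_sqr.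
by apply: integrableZl => //; exact: sqint_integrableM.
Qed.

Lemma sqintZ c f : sqint f -> sqint (fun x => c * f x).
Proof.
move=> sf; apply: sqintP.
  by apply: measurable_funM => //; case: sf.
apply: (@eq_integrable _ _ _ _ _ measurableT
   (fun x => (c ^+ 2)%:E * (f x ^+ 2)%:E)%E).
  by move=> x _ /=; rewrite -EFinM exprMn.
by apply: integrableZl => //; exact: sqint_integrable_sqr.
Qed.

Lemma sqintB f g : sqint f -> sqint g -> sqint (fun x => f x - g x).
Proof.
move=> sf sg; rewrite (_ : (fun _ => _) = (fun x => f x + (-1) * g x)).
  by apply: sqintD => //; exact: sqintZ.
by apply/funext => x; rewrite mulN1r.
Qed.

Lemma sqint0 : sqint (fun=> 0).
Proof.
by split => //; rewrite integral0_eq ?ltry// => x _; rewrite expr0n.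
Qed.

Lemma sqint_sum (I : Type) (r : seq I) (F : I -> T -> R) :
  (forall i, sqint (F i)) -> sqint (fun x => \sum_(i <- r) F i x).
Proof.
move=> sF; elim: r => [|i r IH].
  rewrite (_ : (fun _ => _) = (fun=> 0)); first exact: sqint0.
  by apply/funext => x; rewrite big_nil.
rewrite (_ : (fun _ => _) = (fun x => F i x + \sum_(j <- r) F j x)).
  exact: sqintD.
by apply/funext => x; rewrite big_cons.
Qed.

Lemma ipC f g : ip f g = ip g f.
Proof. by apply: eq_Rintegral => x _; rewrite mulrC. Qed.

Lemma ipDl f g h : sqint f -> sqint g -> sqint h ->
  ip (fun x => f x + g x) h = ip f h + ip g h.
Proof.
move=> sf sg sh; rewrite /ip -RintegralD//; [|exact: sqint_integrableM..].
by apply: eq_Rintegral => x _; rewrite mulrDl.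
Qed.

Lemma ipZl c f h : sqint f -> sqint h -> ip (fun x => c * f x) h = c * ip f h.
Proof.
move=> sf sh; rewrite /ip -RintegralZl//; last exact: sqint_integrableM.
by apply: eq_Rintegral => x _; rewrite mulrA.
Qed.

Lemma ipBl f g h : sqint f -> sqint g -> sqint h ->
  ip (fun x => f x - g x) h = ip f h - ip g h.
Proof.
move=> sf sg sh; rewrite /ip -RintegralB//; [|exact: sqint_integrableM..].
by apply: eq_Rintegral => x _; rewrite mulrBl.
Qed.

Lemma ip0l h : ip (fun=> 0) h = 0.
Proof.
rewrite /ip (_ : (fun _ => _) = (fun=> 0)) ?Rintegral_cst ?mul0r//.
by apply/funext => x; rewrite mul0r.
Qed.

Lemma ip_suml (I : Type) (r : seq I) (F : I -> T -> R) h :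
  (forall i, sqint (F i)) -> sqint h ->
  ip (fun x => \sum_(i <- r) F i x) h = \sum_(i <- r) ip (F i) h.
Proof.
move=> sF sh; elim: r => [|i r IH].
  by rewrite big_nil; under eq_fun do rewrite big_nil; rewrite ip0l.
rewrite big_cons -IH -ipDl//; last exact: sqint_sum.
by under eq_fun do rewrite big_cons.
Qed.

Lemma ipDr f g h : sqint f -> sqint g -> sqint h ->
  ip h (fun x => f x + g x) = ip h f + ip h g.
Proof. by move=> *; rewrite ipC ipDl// !(ipC h). Qed.

Lemma ipBr f g h : sqint f -> sqint g -> sqint h ->
  ip h (fun x => f x - g x) = ip h f - ip h g.
Proof. by move=> *; rewrite ipC ipBl// !(ipC h). Qed.

Lemma ipZr c f h : sqint f -> sqint h -> ip h (fun x => c * f x) = c * ip h f.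
Proof. by move=> *; rewrite ipC ipZl// (ipC h). Qed.

Lemma ip_ge0 f : 0 <= ip f f.
Proof. by apply: Rintegral_ge0 => x _; rewrite -expr2 sqr_ge0. Qed.

(** The quadratic polynomial t |-> ip (f + t g) (f + t g) is nonnegative; evaluate it at its
    minimum, or far out on a line when ip g g = 0. *)
Lemma ip_CS f g : sqint f -> sqint g -> ip f g ^+ 2 <= ip f f * ip g g.
Proof.
move=> sf sg.
have quad t : 0 <= ip f f + t * ip f g *+ 2 + t ^+ 2 * ip g g.
  have st : sqint (fun x => t * g x) by exact: sqintZ.
  have := ip_ge0 (fun x => f x + t * g x).
  rewrite ipDl//; last exact: sqintD.
  rewrite ipDr// (ipC (fun x => t * g x) (fun x => _ + _)) ipDl// !ipZr//.
  rewrite ipZl// => /le_trans; apply.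
  by rewrite le_eqVlt; apply/orP; left; apply/eqP; ring.
have f0 := ip_ge0 f; have g0 := ip_ge0 g.
have [gE|gn0] := eqVneq (ip g g) 0.
  have [->|fg0] := eqVneq (ip f g) 0; first by rewrite expr0n/= mulr_ge0.
  have := quad (- (ip f f + 1) / (ip f g *+ 2)).
  rewrite gE mulr0 addr0 -mulrnAr divfK ?mulrn_eq0//=.
  by move=> ?; exfalso; lra.
have gp : 0 < ip g g by rewrite lt_neqAle eq_sym gn0.
have := quad (- ip f g / ip g g).
rewrite -(ler_pM2r gp) mul0r => /le_trans h.
rewrite -subr_ge0; apply: h.
by rewrite le_eqVlt; apply/orP; left; apply/eqP; field.
Qed.

Lemma ip_le_sqrt f g : sqint f -> sqint g ->
  `|ip f g| <= Num.sqrt (ip f f) * Num.sqrt (ip g g).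
Proof.
move=> sf sg; rewrite -sqrtr_sqr -sqrtrM ?ip_ge0// ler_wsqrtr//.
exact: ip_CS.
Qed.

Definition cvg2 (F : nat -> T -> R) f : Prop :=
  [/\ forall k, sqint (F k), sqint f &
      (fun k => ip (fun x => f x - F k x) (fun x => f x - F k x)) @ \oo --> (0 : R)].

Lemma cvg2_cst f : sqint f -> cvg2 (fun=> f) f.
Proof.
move=> sf; split => //.
rewrite ipBl ?subrr //; last exact: sqintB.
exact: cvg_cst.
Qed.

Lemma cvg2_ip F f G g : cvg2 F f -> cvg2 G g ->
  (fun k => ip (F k) (G k)) @ \oo --> ip f g.
Proof.
move=> [sF sf cF] [sG sg cG].
have sqrt0 u : u @ \oo --> (0 : R) -> (fun k => Num.sqrt (u k : R)) @ \oo --> (0 : R).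
  move=> cu; rewrite -(@sqrtr0 R); apply: continuous_cvg => //.
  exact: sqrt_continuous.
pose a k := Num.sqrt (ip (fun x => f x - F k x) (fun x => f x - F k x)).
pose b k := Num.sqrt (ip (fun x => g x - G k x) (fun x => g x - G k x)).
have ca : a k @[k --> \oo] --> (0:R) by exact: sqrt0.
have cb : b k @[k --> \oo] --> (0:R) by exact: sqrt0.
apply/cvgrPdist_le => e e0.
pose c k := a k * Num.sqrt (ip g g) + b k * Num.sqrt (ip f f) + a k * b k.
have cc : c k @[k --> \oo] --> (0:R).
  rewrite (_ : 0 = 0 * Num.sqrt (ip g g) + 0 * Num.sqrt (ip f f) + 0 * 0); last by ring.
  by apply: cvgD; [apply: cvgD; apply: cvgM => //; exact: cvg_cst|exact: cvgM].
move/cvgr0_norm_le : cc => /(_ _ e0); apply: filterS => k ck.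
apply: le_trans ck; apply: le_trans (ler_norm _).
have sfk : sqint (fun x => f x - F k x) by exact: sqintB.
have sgk : sqint (fun x => g x - G k x) by exact: sqintB.
have -> : ip f g - ip (F k) (G k) =
   ip (fun x => f x - F k x) g + ip (fun x => g x - G k x) f -
   ip (fun x => f x - F k x) (fun x => g x - G k x).
  by rewrite ipBr// !ipBl// (ipC g f) (ipC (G k) f); ring.
by rewrite /c !(le_trans (ler_normB _ _))// lerD ?(le_trans (ler_normD _ _)) ?lerD ?ip_le_sqrt.
Qed.

(** Two sequences with the same limit get close: expand the square and pass to the
    limit in each inner product. *)
Lemma cvg2_dist F G f : cvg2 F f -> cvg2 G f ->
  (fun k => ip (fun x => F k x - G k x) (fun x => F k x - G k x)) @ \oo --> (0 : R).
Proof.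
move=> cF cG; have [sF sf _] := cF; have [sG _ _] := cG.
rewrite (_ : 0 = ip f f - 2 * ip f f + ip f f); last by ring.
rewrite (_ : (fun _ => _) =
    fun k => ip (F k) (F k) - 2 * ip (F k) (G k) + ip (G k) (G k)); last first.
  apply/funext => k; rewrite ipBl ?ipBr//; last exact: sqintB.
  by rewrite (ipC (G k) (F k)); ring.
apply: cvgD; last exact: cvg2_ip.
apply: cvgB; first exact: cvg2_ip.
by apply: cvgM; [exact: cvg_cst|exact: cvg2_ip].
Qed.

Lemma ip_sqrD_le f g : sqint f -> sqint g ->
  ip (fun x => f x + g x) (fun x => f x + g x) <= 2 * ip f f + 2 * ip g g.
Proof.
move=> sf sg; have := ip_ge0 (fun x => f x - g x).
rewrite ipBl ?ipBr//; last exact: sqintB.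
rewrite ipDl ?ipDr//; last exact: sqintD.
by rewrite (ipC g f) => ?; lra.
Qed.

(** A sequence that gets close to a convergent one has the same limit. *)
Lemma cvg2_near F G f : cvg2 F f -> (forall k, sqint (G k)) ->
  (fun k => ip (fun x => F k x - G k x) (fun x => F k x - G k x)) @ \oo --> (0 : R) ->
  cvg2 G f.
Proof.
move=> [sF sf cF] sG cG; split => //.
have c0 : (fun k => 2 * ip (fun x => f x - F k x) (fun x => f x - F k x) +
    2 * ip (fun x => F k x - G k x) (fun x => F k x - G k x)) @ \oo --> (0 : R).
  rewrite (_ : 0 = 2 * 0 + 2 * 0); last by ring.
  by apply: cvgD; apply: cvgM => //; exact: cvg_cst.
apply: (squeeze_cvgr _ (cvg_cst 0) c0); apply: nearW => k.
rewrite ip_ge0/=.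
rewrite (_ : (fun x => f x - G k x) = fun x => (f x - F k x) + (F k x - G k x)).
  by apply: ip_sqrD_le; exact: sqintB.
by apply/funext => x; rewrite subrKA.
Qed.

(** The squared distances may be infinite at first; they are eventually below 1, and one
    finite distance already makes the limit square integrable. *)
Lemma cvg2_of_ereal F f : measurable_fun setT f -> (forall k, sqint (F k)) ->
  (fun k => \int[m]_x ((f x - F k x) ^+ 2)%:E)%E @ \oo --> 0%E ->
  cvg2 F f.
Proof.
move=> mf sF cF.
have : \forall k \near \oo, (\int[m]_x ((f x - F k x) ^+ 2)%:E < 1)%E.
  move/fine_cvgP : (cF) => [nf cf].
  move/cvgr0_norm_lt : cf => /(_ _ ltr01).
  move: nf; apply: filterS2 => k fk; rewrite /= -lte_fin.
  rewrite ger0_norm ?fine_ge0 ?fineK//; apply: integral_ge0 => x _.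
  by rewrite lee_fin sqr_ge0.
move=> [k0 _ /(_ k0 (leqnn _)) hk0].
have sf : sqint f.
  rewrite (_ : f = fun x => (f x - F k0 x) + F k0 x); last first.
    by apply/funext => x; rewrite subrK.
  apply: sqintD => //; split; last by rewrite (lt_trans hk0)// ltry.
  by apply: measurable_funB => //; case: (sF k0).
split => //.
have /fine_cvgP[_] := cF.
apply: cvg_trans; apply: near_eq_cvg; apply: nearW => k /=.
by rewrite /ip /Rintegral; congr fine; apply: eq_integral => x _; rewrite expr2.
Qed.

End SquareIntegrable.

(** * Fubini for real-valued integrals *)

Section RealFubini.
Context {d1 d2 : measure_display} {T1 : measurableType d1} {T2 : measurableType d2}.
Context {R : realType}.
Variables (m1 : {sigma_finite_measure set T1 -> \bar R}).
Variables (m2 : {sigma_finite_measure set T2 -> \bar R}).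
Variable f : T1 * T2 -> R.
Hypothesis fi : (m1 \x m2)%E.-integrable setT (EFin \o f).

Let fine_integrable d (T : measurableType d) (m : {measure set T -> \bar R})
    (h : T -> \bar R) : m.-integrable setT h ->
  m.-integrable setT (EFin \o (fine \o h)) /\
  fine (\int[m]_x h x)%E = \int[m]_x fine (h x).
Proof.
move=> hi; have mh : measurable_fun setT h by exact: measurable_int hi.
have mfh : measurable_fun setT (EFin \o (fine \o h)).
  by apply/measurable_EFinP; exact: measurableT_comp.
split; last first.
  congr fine; apply: ae_eq_integral => //.
  have := integrable_ae measurableT hi; apply: filterS => x /= /(_ I) hx _.
  by rewrite fineK.
apply: le_integrable hi => // x _ /=.
by case: (h x) => //= *; rewrite ?normr0 ?leey.
Qed.

Lemma Rfubini_integrable1 :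
  m1.-integrable setT (EFin \o (fun x => \int[m2]_y f (x, y))).
Proof. by have [] := fine_integrable (integrable_fubini_F fi). Qed.

Lemma Rfubini1 : \int[(m1 \x m2)%E]_z f z = \int[m1]_x \int[m2]_y f (x, y).
Proof.
have [_ <-] := fine_integrable (integrable_fubini_F fi).
by rewrite integral12_prod_meas1.
Qed.

Let integrable_G : m2.-integrable setT (fubini_G m1 (EFin \o f)).
Proof.
have mf : measurable_fun setT (EFin \o f) by case/integrableP : fi.
apply/integrableP; split; first exact: (measurable_fubini_G fi).
apply: le_lt_trans ((integrable21ltyP _ _ mf).1 fi).
apply: ge0_le_integral => //.
- by apply: measurableT_comp => //; exact: (measurable_fubini_G fi).
- apply: (measurable_fun_fubini_tonelli_G (abse \o (EFin \o f))) => //=.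
  exact: measurableT_comp.
- move=> y _; apply: le_abse_integral => //.
  exact: measurableT_comp.
Qed.

Lemma Rfubini_integrable2 :
  m2.-integrable setT (EFin \o (fun y => \int[m1]_x f (x, y))).
Proof. by have [] := fine_integrable integrable_G. Qed.

Lemma Rfubini2 : \int[(m1 \x m2)%E]_z f z = \int[m2]_y \int[m1]_x f (x, y).
Proof.
have [_ <-] := fine_integrable integrable_G.
by rewrite integral21_prod_meas1.
Qed.

End RealFubini.

Section Tensor.
Context {d1 d2 : measure_display} {T1 : measurableType d1} {T2 : measurableType d2}.
Context {R : realType}.
Variables (m1 : {sigma_finite_measure set T1 -> \bar R}).
Variables (m2 : {sigma_finite_measure set T2 -> \bar R}).

Lemma measurable_Rintegral_slice (f : T1 * T2 -> R) : measurable_fun setT f ->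
  measurable_fun setT (fun x => \int[m2]_y f (x, y)).
Proof.
move=> mf; have mfE : measurable_fun setT (EFin \o f) by exact/measurable_EFinP.
apply: (measurableT_comp (f := fine)) => //.
rewrite (_ : (fun x => _) = (fubini_F m2 ((EFin \o f)^\+) \- fubini_F m2 ((EFin \o f)^\-))%E).
  apply: emeasurable_funB; apply: measurable_fun_fubini_tonelli_F => //.
    exact: measurable_funepos.
  exact: measurable_funeneg.
apply/funext => x; rewrite [LHS]integralE.
under eq_integral do rewrite (@funepos_comp _ _ _ (EFin \o f) (pair x))/=.
by under [X in (_ - X)%E = _]eq_integral do rewrite (@funeneg_comp _ _ _ (EFin \o f) (pair x))/=.
Qed.

Variables (a : T1 -> R) (b : T2 -> R).
Hypotheses (ia : m1.-integrable setT (EFin \o a)).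
Hypotheses (ib : m2.-integrable setT (EFin \o b)).

(** Used for laws of independent pairs, for random variables over a time interval, and for
    pairs of times. *)
Lemma tensor_integrable :
  (m1 \x m2)%E.-integrable setT (EFin \o (fun z => a z.1 * b z.2)).
Proof.
have ma : measurable_fun setT a by apply/measurable_EFinP; case/integrableP : ia.
have mb : measurable_fun setT b by apply/measurable_EFinP; case/integrableP : ib.
apply/integrable12ltyP.
  apply/measurable_EFinP; apply: measurable_funM.
    exact: (measurableT_comp ma).
  exact: (measurableT_comp mb).
rewrite (_ : (\int[m1]_x _)%E = (\int[m1]_x (`|a x|%:E * \int[m2]_y `|b y|%:E))%E); last first.
  apply: eq_integral => x _; rewrite -ge0_integralZl//=.
  - by apply: eq_integral => y _; rewrite normrM EFinM.
  - by apply/measurable_EFinP; exact: measurableT_comp.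
rewrite ge0_integralZr//; last 2 first.
- by apply/measurable_EFinP; exact: measurableT_comp.
- by apply: integral_ge0 => y _; rewrite lee_fin.
rewrite lte_mul_pinfty//.
- by apply: integral_ge0 => x _; rewrite lee_fin.
- rewrite ge0_fin_numE; last by apply: integral_ge0 => x _; rewrite lee_fin.
  by case/integrableP : ia.
- by case/integrableP : ib.
Qed.

Lemma tensor_Rintegral :
  \int[(m1 \x m2)%E]_z (a z.1 * b z.2) = (\int[m1]_x a x) * (\int[m2]_y b y).
Proof.
rewrite (Rfubini1 tensor_integrable) -RintegralZr//.
by apply: eq_Rintegral => x _; rewrite /= RintegralZl.
Qed.

End Tensor.

Section Triangle.
Context {R : realType}.
Notation mu := (@lebesgue_measure R).
Variable k : measurableTypeR R * measurableTypeR R -> R.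
Hypothesis ki : (mu \x mu)%E.-integrable setT (EFin \o k).

(** The diagonal is null, so the square is the union of two closed triangles; each is swept
    along its own long side. *)
Lemma integral_triangles :
  \int[(mu \x mu)%E]_z k z =
  \int[mu]_s \int[mu]_(r in `]-oo, s]) k (s, r) +
  \int[mu]_r \int[mu]_(s in `]-oo, r]) k (s, r).
Proof.
have mk : measurable_fun setT k by apply/measurable_EFinP; case/integrableP : ki.
pose lo (z : measurableTypeR R * measurableTypeR R) := k z * (z.2 <= z.1 :> R)%R%:R.
pose hi (z : measurableTypeR R * measurableTypeR R) := k z * (z.1 < z.2 :> R)%R%:R.
have mb (b : measurableTypeR R * measurableTypeR R -> bool) : measurable_fun setT b ->
    (mu \x mu)%E.-integrable setT (EFin \o (fun z => k z * (b z)%:R)).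
  move=> mb; apply: le_integrable ki => //.
    apply/measurable_EFinP; apply: measurable_funM => //.
    exact: (@measurableT_comp _ _ _ _ _ _ (fun b : bool => b%:R : R)).
  move=> z _ /=; rewrite lee_fin normrM; case: (b z); first by rewrite normr1 mulr1.
  by rewrite normr0 mulr0.
have ilo : (mu \x mu)%E.-integrable setT (EFin \o lo).
  by apply: mb; apply: measurable_fun_ler; [exact: measurable_snd|exact: measurable_fst].
have ihi : (mu \x mu)%E.-integrable setT (EFin \o hi).
  by apply: mb; apply: measurable_fun_ltr; [exact: measurable_fst|exact: measurable_snd].
transitivity (\int[(mu \x mu)%E]_z (lo z + hi z)).
  apply: eq_Rintegral => z _; rewrite /lo /hi -mulrDr.
  by case: leP => _; rewrite ?addr0 ?add0r mulr1.
rewrite RintegralD//; congr (_ + _).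
  rewrite (Rfubini1 ilo); apply: eq_Rintegral => s _.
  rewrite [RHS]Rintegral_mkcond; apply: eq_Rintegral => r _.
  by rewrite patchE mem_setE in_itv/= /lo /=; case: ifPn => h; rewrite ?mulr1 ?mulr0.
rewrite (Rfubini2 ihi).
apply: eq_Rintegral => r _.
rewrite [RHS]/Rintegral -integral_itv_bndo_bndc; last first.
  apply: measurable_funTS; apply/measurable_EFinP.
  exact: (measurableT_comp mk (measurable_pair2 r)).
rewrite -/(Rintegral mu _ _) [RHS]Rintegral_mkcond; apply: eq_Rintegral => s _.
by rewrite patchE mem_setE in_itv/= /hi /=; case: ifPn => h; rewrite ?mulr1 ?mulr0.
Qed.

End Triangle.

(** * Moments of the centred normal law *)

Section GaussianMoments.
Context {R : realType}.
Variables (s : R) (s0 : 0 < s).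
Notation mu := (@lebesgue_measure R).
Local Notation p := (normal_pdf 0 s).

Let sn0 : s != 0. Proof. by rewrite gt_eqF. Qed.

Let pE x : p x = normal_peak s * expR (- x ^+ 2 / (s ^+ 2 *+ 2)).
Proof. by rewrite normal_pdfE// /normal_fun subr0. Qed.

Let is_derive_p (x : R) : is_derive x 1 p (- (x / s ^+ 2) * p x).
Proof.
have -> : p = (fun x => normal_peak s *: expR (- x ^+ 2 / (s ^+ 2 *+ 2))).
  by apply/funext => y; rewrite pE.
apply: is_derive_eq.
by rewrite /GRing.scale/=; field; rewrite ?mulrn_eq0 ?expf_neq0.
Qed.

Let cvg_p : p x @[x --> +oo] --> (0 : R).
Proof.
rewrite (_ : p = fun x => normal_peak s * gauss_fun (x / (Num.sqrt 2 * s))); last first.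
  apply/funext => x; rewrite pE /gauss_fun; congr (_ * expR _).
  by rewrite expr_div_n exprMn sqr_sqrtr//; field.
rewrite -(mulr0 (normal_peak s)); apply: cvgM; first exact: cvg_cst.
apply: (@cvg_comp _ _ _ (fun x => x / (Num.sqrt 2 * s)) (@gauss_fun R)); last exact: cvg_gauss_fun.
apply: gt0_cvgMly; last exact: cvg_id.
by rewrite invr_gt0 mulr_gt0// sqrtr_gt0.
Qed.

Let cp : continuous p.
Proof. exact: continuous_normal_pdf. Qed.

Let cxp : continuous (fun x : R => x * p x).
Proof. by move=> x; apply: cvgM; [exact: cvg_id|exact: cp]. Qed.

Let p_ge0 x : 0 <= p x. Proof. exact: normal_pdf_ge0. Qed.

(** - s^2 p is an antiderivative of x p(x). *)
Let integral_tail (y : R) : 0 <= y ->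
  (\int[mu]_(x in `[y, +oo[) (x * p x)%:E = (s ^+ 2 * p y)%:E)%E.
Proof.
move=> y0.
have dF (x : R) : is_derive x 1 (fun x => - (s ^+ 2) * p x) (x * p x).
  have dp := is_derive_p x.
  rewrite (_ : x * p x = - s ^+ 2 *: (- (x / s ^+ 2) * p x)).
    exact: (@is_deriveZ _ _ _ p (- s ^+ 2) x 1 _ dp).
  by rewrite /GRing.scale/=; field.
rewrite (@ge0_continuous_FTC2y _ _ (fun x => - (s ^+ 2) * p x) _ 0).
- by rewrite -EFinB sub0r mulNr opprK.
- by move=> x yx; rewrite mulr_ge0// (le_trans y0).
- exact: continuous_subspaceT.
- have := cvgM (cvg_cst (- s ^+ 2)) cvg_p; rewrite mulr0; exact.
- by move=> x _; have [] := dF x.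
- by apply: cvg_at_right_filter; apply: cvgM; [exact: cvg_cst|exact: cp].
- by move=> x _; rewrite derive1E; have [_ ->] := dF x.
Qed.

(** The density of the normal law is its Radon-Nikodym derivative almost everywhere, so it may
    replace the latter in the change of variables formula. *)
Lemma normal_prob_integral_ge0 (f : R -> R) :
  measurable_fun setT f -> (forall x, 0 <= f x) ->
  (\int[normal_prob 0 s]_x (f x)%:E = \int[mu]_x (f x * p x)%:E)%E.
Proof.
move=> mf f0.
have dom := normal_prob_dominates 0 s.
rewrite -(Radon_Nikodym_SigmaFinite.change_of_variables dom)//=; last first.
  exact/measurable_EFinP.
apply: ae_eq_integral => //.
- apply: emeasurable_funM; first exact/measurable_EFinP.
  exact: (measurable_int mu (Radon_Nikodym_SigmaFinite.f_integrable dom)).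
- apply/measurable_EFinP; apply: measurable_funM => //.
  exact: measurable_normal_pdf.
- under [X in ae_eq _ _ _ X]eq_fun do rewrite EFinM.
  apply: ae_eqe_mul2l.
  apply: integral_ae_eq => //.
  + exact: Radon_Nikodym_SigmaFinite.f_integrable.
  + by apply/measurable_EFinP; exact: measurable_normal_pdf.
  + by move=> E _ mE; rewrite -Radon_Nikodym_SigmaFinite.f_integral.
Qed.

Let mp : measurable_fun setT p. Proof. exact: measurable_normal_pdf. Qed.

(** Write one factor x as the length of [0, x] and exchange the integrals: what remains
    are the tails of x p(x), that is, s^2 p. *)
Let integral_half_sqr :
  (\int[mu]_(x in `[0%R, +oo[) (x ^+ 2 * p x)%:E =
   (s ^+ 2)%:E * \int[mu]_(x in `[0%R, +oo[) (p x)%:E)%E.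
Proof.
pose h (z : R * R) : \bar R := ((0 <= z.2 <= z.1)%R%:R * (z.1 * p z.1))%:E.
have h0 z : (0 <= h z)%E.
  rewrite lee_fin; have [/andP[z20 z21]|] := boolP (0 <= z.2 <= z.1).
    by rewrite mul1r mulr_ge0// (le_trans z20).
  by rewrite mul0r.
have mh : measurable_fun setT h.
  apply/measurable_EFinP; apply: measurable_funM.
    apply: (@measurableT_comp _ _ _ _ _ _ (fun b : bool => b%:R : R)) => //.
    by apply: measurable_and; apply: measurable_fun_ler.
  apply: (@measurableT_comp _ _ _ _ _ _ (fun x : R => x * p x)) => //.
  exact: measurable_funM.
have := @fubini_tonelli _ _ _ _ _ mu mu h mh h0.
rewrite [in LHS](_ : (fun x => \int[mu]_y h (x, y))%E =
    (fun x => (x ^+ 2 * p x)%:E) \_ `[0, +oo[); last first.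
  apply/funext => x; rewrite patchE.
  rewrite (_ : (fun y => h (x, y)) = (fun=> (x * p x)%:E) \_ `[0, x]); last first.
    apply/funext => y; rewrite /h patchE /= mem_setE in_itv/=.
    by case: ifPn => _; rewrite ?mul1r ?mul0r.
  rewrite -integral_mkcond integral_cst//= lebesgue_measure_itv/= lte_fin.
  rewrite mem_setE in_itv/= andbT; have [x0|x0] := ltP 0 x.
    by rewrite (ltW x0) -EFinD -EFinM subr0 expr2; congr EFin; ring.
  rewrite mule0; case: ifPn => // x0'.
  by rewrite (_ : x = 0) ?expr0n ?mul0r//; apply/eqP; rewrite eq_le x0 x0'.
rewrite -integral_mkcond => ->.
rewrite (_ : (fun y => \int[mu]_x h (x, y))%E =
    (fun y => (s ^+ 2)%:E * (p y)%:E)%E \_ `[0, +oo[); last first.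
  apply/funext => y; rewrite patchE mem_setE in_itv/= andbT; case: ifPn => y0.
    rewrite -EFinM -integral_tail//.
    rewrite [RHS]integral_mkcond; apply: eq_integral => x _.
    rewrite /h patchE mem_setE in_itv/= y0/= andbT.
    by case: ifPn => _; rewrite ?mul1r ?mul0r.
  by rewrite integral0_eq// => x _; rewrite /h /= (negbTE y0) mul0r.
rewrite -integral_mkcond ge0_integralZl//=.
- by apply: measurable_funTS; exact/measurable_EFinP.
- by move=> x _; rewrite lee_fin.
- by rewrite lee_fin sqr_ge0.
Qed.

Lemma normal_prob_sqr : (\int[normal_prob 0 s]_x (x ^+ 2)%:E = (s ^+ 2)%:E)%E.
Proof.
have pN : p =1 p \o -%R by move=> x; rewrite /= !pE sqrrN.
rewrite normal_prob_integral_ge0//; last by move=> x; rewrite sqr_ge0.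
rewrite ge0_symfun_integralT; first last.
- by move=> x; rewrite /= sqrrN [in RHS]pN/= opprK.
- by move=> x; apply: cvgM; [exact: exprn_continuous|exact: cp].
- by move=> x; rewrite mulr_ge0// sqr_ge0.
rewrite -set_itvcy integral_half_sqr muleCA.
rewrite (_ : `[0, +oo[%classic = [set x : R | 0 <= x]); last by rewrite set_itvcy.
by rewrite -ge0_symfun_integralT// integral_normal_pdf mule1.
Qed.

Lemma normal_prob_integrable_id : (normal_prob 0 s).-integrable setT (fun x : R => x%:E).
Proof.
have h : (normal_prob 0 s).-integrable setT (fun x : R => (1 + x ^+ 2)%:E).
  apply/integrableP; split.
    by apply/measurable_EFinP; apply: measurable_funD => //; apply: measurable_funX.
  under eq_integral do rewrite /= ger0_norm ?addr_ge0 ?sqr_ge0// EFinD.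
  rewrite ge0_integralD//=.
  - by rewrite normal_prob_sqr integral_cst//= probability_setT mule1 ltry.
  - by move=> x _; rewrite lee_fin sqr_ge0.
  - by apply/measurable_EFinP; exact: measurable_funX.
apply: le_integrable h => //; first exact/measurable_EFinP.
move=> x _ /=; rewrite lee_fin [leRHS]ger0_norm ?addr_ge0 ?sqr_ge0//.
have := sqr_ge0 (`|x| - 1); rewrite sqrrB1 real_normK ?num_real// => ?.
have := normr_ge0 x; lra.
Qed.

(** x = 2 max(x, 0) - |x|, and by symmetry both terms have the same integral. *)
Lemma normal_prob_mean : (\int[normal_prob 0 s]_x x%:E = 0)%E.
Proof.
have pN : p =1 p \o -%R by move=> x; rewrite /= !pE sqrrN.
have tailE : (\int[mu]_(x in `[0%R, +oo[) (`|x| * p x)%:E = (s ^+ 2 * p 0)%:E)%E.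
  rewrite -integral_tail//; apply: eq_integral => x.
  by rewrite inE/= in_itv/= andbT => x0; rewrite ger0_norm.
have absE : (\int[normal_prob 0 s]_x `|x|%:E = (2 * (s ^+ 2 * p 0))%:E)%E.
  rewrite normal_prob_integral_ge0//= ge0_symfun_integralT; first last.
  - by move=> x; rewrite /= normrN [in RHS]pN/= opprK.
  - by move=> x; apply: cvgM; [exact: norm_continuous|exact: cp].
  - by move=> x; rewrite mulr_ge0.
  by rewrite -set_itvcy tailE EFinM.
have posE : (\int[normal_prob 0 s]_x (2 * Num.max x 0)%:E = (2 * (s ^+ 2 * p 0))%:E)%E.
  rewrite normal_prob_integral_ge0//=; last 2 first.
  - by apply: measurable_funM => //; exact: measurable_maxr.
  - by move=> x; rewrite mulr_ge0// le_max lexx orbT.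
  rewrite EFinM -integral_tail// -ge0_integralZl//=; last 2 first.
  - by apply: measurable_funTS; apply/measurable_EFinP; apply: measurable_funM.
  - by move=> x; rewrite in_itv/= andbT => x0; rewrite lee_fin mulr_ge0.
  rewrite [RHS]integral_mkcond; apply: eq_integral => x _.
  rewrite patchE mem_setE in_itv/= andbT; case: ifPn => x0.
    by rewrite (max_idPl x0) -EFinM mulrA.
  by rewrite (max_idPr _) ?mulr0 ?mul0r// ltW// ltNge.
have i1 : (normal_prob 0 s).-integrable setT (EFin \o (fun x : R => 2 * Num.max x 0)).
  apply/integrableP; split.
    by apply/measurable_EFinP; apply: measurable_funM => //; exact: measurable_maxr.
  under eq_integral do rewrite /= ger0_norm ?mulr_ge0 ?le_max ?lexx ?orbT//.
  by rewrite posE ltry.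
have i2 : (normal_prob 0 s).-integrable setT (EFin \o (fun x : R => `|x|)).
  by have /integrable_norm := normal_prob_integrable_id.
transitivity (\int[normal_prob 0 s]_x (2 * Num.max x 0 - `|x|)%:E)%E.
  apply: eq_integral => x _; congr EFin.
  have [x0|x0] := leP 0 x; first by rewrite ger0_norm//; ring.
  by rewrite ltr0_norm//; ring.
by rewrite integralB_EFin//= posE absE subee.
Qed.

End GaussianMoments.

(** * Independence and the integral of a product *)

Section Independence.
Context {R : realType} {d : measure_display} {Omega : measurableType d}.
Variables (P : probability Omega R) (N : probability (measurableTypeR R) R).
Variables (Z D : Omega -> measurableTypeR R).
Hypotheses (mZ : measurable_fun setT Z) (mD : measurable_fun setT D).
Hypothesis indep : forall A B : set (measurableTypeR R), measurable A -> measurable B ->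
  P (Z @^-1` A `&` D @^-1` B) = (P (Z @^-1` A) * N B)%E.

Let mZp := isMeasurableFun.Build _ _ _ _ Z mZ.
HB.instance Definition _ := mZp.

Let pair_ (w : Omega) : measurableTypeR R * measurableTypeR R := (Z w, D w).

Let mpair : measurable_fun setT pair_.
Proof. exact: measurable_fun_pair. Qed.

HB.instance Definition _ := isMeasurableFun.Build _ _ _ _ pair_ mpair.

Let lawZ : probability (measurableTypeR R) R := distribution P Z.

Let joint_law X : measurable X -> (lawZ \x N)%E X = distribution P pair_ X.
Proof.
apply: product_measure_unique => A B mA mB.
by rewrite /= -indep//.
Qed.

(** The joint law of Z and D is the product of their laws, so that Fubini factors the
    integral. *)
Lemma indep_integrableM (g : R -> R) :
  P.-integrable setT (EFin \o Z) -> N.-integrable setT (EFin \o g) ->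
  P.-integrable setT (EFin \o (fun w => Z w * g (D w))) /\
  \int[P]_w (Z w * g (D w)) = (\int[P]_w Z w) * (\int[N]_y g y).
Proof.
move=> iZ iN.
pose h (z : measurableTypeR R * measurableTypeR R) : \bar R := (z.1 * g z.2)%:E.
have mg : measurable_fun setT g by apply/measurable_EFinP; case/integrableP : iN.
have mh : measurable_fun setT h.
  apply/measurable_EFinP; apply: measurable_funM => //.
  exact: (measurableT_comp mg).
have iZ' : lawZ.-integrable setT (fun z : R => z%:E).
  apply: integrable_pushforward => //=.
  exact/measurable_EFinP.
have ih : (lawZ \x N)%E.-integrable setT h by exact: (tensor_integrable iZ' iN).
have ih' : (distribution P pair_).-integrable setT h.
  apply/integrableP; split => //.
  rewrite (eq_measure_integral (lawZ \x N)%E); last by move=> A mA _; exact/esym/joint_law.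
  by case/integrableP : ih.
have iP : P.-integrable setT (h \o pair_).
  apply/integrableP; split; first exact: measurableT_comp.
  case/integrableP : ih' => _; rewrite ge0_integral_distribution//.
  exact: measurableT_comp.
split => //.
transitivity (\int[distribution P pair_]_z (z.1 * g z.2)).
  by rewrite /Rintegral integral_distribution.
rewrite /Rintegral (eq_measure_integral (lawZ \x N)%E); last first.
  by move=> A mA _; exact/esym/joint_law.
rewrite -/(Rintegral _ _ _) (tensor_Rintegral iZ' iN); congr (_ * _).
by rewrite /Rintegral integral_distribution//; exact/measurable_EFinP.
Qed.

End Independence.

(** * Brownian increments *)

(** Bounded coefficients multiply increments that are merely square integrable. *)
Lemma sqint_bounded d (T : measurableType d) (R : realType)
    (m : {measure set T -> \bar R}) (M : R) (f g : T -> R) :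
  measurable_fun setT g -> (forall x, `|g x| <= M) -> sqint m f ->
  sqint m (fun x => g x * f x).
Proof.
move=> mg gM sf; apply: sqintP; first by apply: measurable_funM => //; case: sf.
have h : m.-integrable setT (fun x => (M ^+ 2)%:E * (f x ^+ 2)%:E)%E.
  by apply: integrableZl => //; exact: sqint_integrable_sqr.
apply: le_integrable h => //.
  by apply/measurable_EFinP/measurable_funX/measurable_funM => //; case: sf.
move=> x _ /=; rewrite lee_fin exprMn !normrM ler_wpM2r//.
by rewrite ler_pM// (le_trans (gM x))// ler_norm.
Qed.

Section BrownianMoments.
Context {R : realType} {d : measure_display} {Omega : measurableType d}.
Variables (P : probability Omega R) (F : R -> set (set Omega)).
Variables (W : R -> Omega -> R).
Hypotheses (hF : complete_filtration P F) (hW : brownian_motion P F W).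

Lemma sqint_cst (c : R) : sqint P (fun=> c).
Proof.
split => //; rewrite integral_cst//= probability_setT mule1 ltry//.
Qed.

(** Makes the closure properties of measurable functions available for a
    sub-sigma-algebra. *)
Lemma measurable_wrtP t (f : Omega -> R) : 0 <= t ->
  measurable_wrt (F t) f <->
  measurable_fun setT (f : g_sigma_algebraType (F t) -> R).
Proof.
move=> t0; have sE := sigma_algebra_id (filtration_sigma hF t0).
split=> [mf _ B mB|mf B mB].
  by rewrite setTI /measurable/= sE; exact: mf.
by have := mf measurableT B mB; rewrite setTI {1}/measurable/= sE.
Qed.

Lemma measurable_wrt_homo s t (f : Omega -> R) : 0 <= s -> s <= t ->
  measurable_wrt (F s) f -> measurable_wrt (F t) f.
Proof. by move=> s0 st mf B mB; apply: (filtration_homo hF s0 st); exact: mf. Qed.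

Lemma measurable_wrt_fun t (f : Omega -> R) : 0 <= t ->
  measurable_wrt (F t) f -> measurable_fun setT f.
Proof.
by move=> t0 mf _ B mB; rewrite setTI; apply: (filtration_sub hF t0); exact: mf.
Qed.

Lemma measurable_wrtM t (f g : Omega -> R) : 0 <= t ->
  measurable_wrt (F t) f -> measurable_wrt (F t) g ->
  measurable_wrt (F t) (fun x => f x * g x).
Proof.
by move=> t0 /measurable_wrtP-/(_ t0) mf /measurable_wrtP-/(_ t0) mg;
  apply/measurable_wrtP => //; exact: measurable_funM.
Qed.

Lemma measurable_wrtB t (f g : Omega -> R) : 0 <= t ->
  measurable_wrt (F t) f -> measurable_wrt (F t) g ->
  measurable_wrt (F t) (fun x => f x - g x).
Proof.
by move=> t0 /measurable_wrtP-/(_ t0) mf /measurable_wrtP-/(_ t0) mg;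
  apply/measurable_wrtP => //; exact: measurable_funB.
Qed.

Lemma measurable_wrt_cst t (c : R) : 0 <= t -> measurable_wrt (F t) (fun=> c).
Proof. by move=> t0; apply/measurable_wrtP. Qed.

Lemma measurable_increment s t : 0 <= s -> s <= t ->
  measurable_wrt (F t) (increment W s t).
Proof.
move=> s0 st; have t0 := le_trans s0 st.
apply: measurable_wrtB => //; first exact: (bm_adapted hW).
by apply: (measurable_wrt_homo s0 st); exact: (bm_adapted hW).
Qed.

Lemma increment_indep s t (Z : Omega -> R) : 0 <= s -> s < t ->
    measurable_wrt (F s) Z ->
  forall A B : set (measurableTypeR R), measurable A -> measurable B ->
  P (Z @^-1` A `&` increment W s t @^-1` B) =
  (P (Z @^-1` A) * normal_prob 0 (Num.sqrt (t - s)) B)%E.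
Proof.
move=> s0 st mZ A B mA mB.
by rewrite (bm_indep hW s0 st (mZ _ mA))// (bm_normal hW).
Qed.

Lemma increment_mean s t (Z : Omega -> R) : 0 <= s -> s <= t ->
  measurable_wrt (F s) Z -> P.-integrable setT (EFin \o Z) ->
  \int[P]_w (Z w * increment W s t w) = 0.
Proof.
move=> s0; rewrite le_eqVlt => /predU1P[<-|st] mZ iZ.
  rewrite (_ : (fun w => _) = fun=> 0) ?Rintegral_cst ?mul0r//.
  by apply/funext => w; rewrite /increment subrr mulr0.
have sp : 0 < Num.sqrt (t - s) by rewrite sqrtr_gt0 subr_gt0.
have mD := measurable_wrt_fun (le_trans s0 (ltW st)) (measurable_increment s0 (ltW st)).
have [_] := @indep_integrableM _ _ _ P (normal_prob 0 (Num.sqrt (t - s)))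
  Z (increment W s t) (measurable_wrt_fun s0 mZ) mD (increment_indep s0 st mZ)
  id iZ (normal_prob_integrable_id sp).
by rewrite [X in _ * X]/Rintegral normal_prob_mean// mulr0.
Qed.

Lemma increment_sqr s t (Z : Omega -> R) : 0 <= s -> s <= t ->
  measurable_wrt (F s) Z -> P.-integrable setT (EFin \o Z) ->
  P.-integrable setT (EFin \o (fun w => Z w * (increment W s t w) ^+ 2)) /\
  \int[P]_w (Z w * (increment W s t w) ^+ 2) = (\int[P]_w Z w) * (t - s).
Proof.
move=> s0; rewrite le_eqVlt => /predU1P[<-|st] mZ iZ.
  rewrite (_ : (fun w => _) = fun=> 0); last first.
    by apply/funext => w; rewrite /increment subrr expr0n mulr0.
  by rewrite Rintegral_cst ?mul0r// subrr mulr0; split => //; exact: integrable0.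
have sp : 0 < Num.sqrt (t - s) by rewrite sqrtr_gt0 subr_gt0.
have mD := measurable_wrt_fun (le_trans s0 (ltW st)) (measurable_increment s0 (ltW st)).
have i2 : (normal_prob 0 (Num.sqrt (t - s))).-integrable setT
    (EFin \o (fun x : R => x ^+ 2)).
  apply/integrableP; split; first by apply/measurable_EFinP; exact: measurable_funX.
  under eq_integral do rewrite /= ger0_norm ?sqr_ge0//.
  by rewrite normal_prob_sqr// ltry.
have [h1 h2] := @indep_integrableM _ _ _ P (normal_prob 0 (Num.sqrt (t - s)))
  Z (increment W s t) (measurable_wrt_fun s0 mZ) mD (increment_indep s0 st mZ)
  (fun x => x ^+ 2) iZ i2.
split => //; rewrite h2; congr (_ * _).
by rewrite /Rintegral normal_prob_sqr// sqr_sqrtr// subr_ge0 ltW.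
Qed.

Lemma sqint_increment s t (Z : Omega -> R) : 0 <= s -> s <= t ->
  measurable_wrt (F s) Z -> sqint P Z -> sqint P (fun w => Z w * increment W s t w).
Proof.
move=> s0 st mZ sZ; apply: sqintP.
  apply: measurable_funM; first exact: measurable_wrt_fun mZ.
  exact: (measurable_wrt_fun (le_trans s0 st) (measurable_increment s0 st)).
have [+ _] := increment_sqr s0 st (measurable_wrtM s0 mZ mZ) (sqint_integrableM sZ sZ).
by apply: eq_integrable => // w _ /=; rewrite exprMn !expr2.
Qed.

End BrownianMoments.

(** * Isometry for elementary integrands *)

Section ElementaryIntegrals.
Context {R : realType} {d : measure_display} {Omega : measurableType d}.
Variables (P : probability Omega R) (F : R -> set (set Omega)).
Variables (W : R -> Omega -> R).
Hypotheses (hF : complete_filtration P F) (hW : brownian_motion P F W).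
Notation mu := (@lebesgue_measure R).
Notation muP := (mu \x P)%E.

Record elementary := Elementary {
  el_coef : Omega -> R ; el_start : R ; el_stop : R }.

Record predictable (e : elementary) : Prop := {
  el_start_ge0 : 0 <= el_start e ;
  el_le : el_start e <= el_stop e ;
  el_adapted : measurable_wrt (F (el_start e)) (el_coef e) ;
  el_bounded : exists M, forall w, `|el_coef e w| <= M }.

Definition el_fun (e : elementary) (z : measurableTypeR R * Omega) : R :=
  el_coef e z.2 * \1_`]el_start e, el_stop e] z.1.

Definition el_int (e : elementary) (w : Omega) : R :=
  el_coef e w * increment W (el_start e) (el_stop e) w.

Lemma el_measurable e : predictable e -> measurable_fun setT (el_coef e).
Proof. by move=> [a0 _ ma _]; exact: measurable_wrt_fun hF _ _ a0 ma. Qed.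

Lemma el_sqint e : predictable e -> sqint P (el_coef e).
Proof.
move=> pe; have [_ _ _ [M hM]] := pe.
have := sqint_bounded (el_measurable pe) hM (sqint_cst P 1).
by under eq_fun do rewrite mulr1.
Qed.

Lemma sqint_el_int e : predictable e -> sqint P (el_int e).
Proof.
move=> pe; have [a0 ab ma _] := pe.
exact: (sqint_increment hF hW a0 ab ma (el_sqint pe)).
Qed.

Lemma measurable_el_fun e : predictable e -> measurable_fun setT (el_fun e).
Proof.
move=> pe; apply: measurable_funM.
  exact: (measurableT_comp (el_measurable pe)).
exact: (measurableT_comp (f := \1_`]el_start e, el_stop e] : measurableTypeR R -> R)).
Qed.

Lemma integral_itv_tensor (a b : R) (f : Omega -> R) : a <= b ->
  P.-integrable setT (EFin \o f) ->
  muP.-integrable setT (EFin \o (fun z : measurableTypeR R * Omega =>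
    f z.2 * \1_`]a, b] z.1)) /\
  \int[muP]_z (f z.2 * \1_`]a, b] z.1) = (b - a) * \int[P]_w f w.
Proof.
move=> ab iF.
have iI := integrable_indic_itv a b false false.
have E (z : measurableTypeR R * Omega) :
  \1_`]a, b] z.1 * f z.2 = f z.2 * \1_`]a, b] z.1 by rewrite mulrC.
split.
  by have := tensor_integrable iI iF; apply: eq_integrable => // z _; congr EFin; exact: E.
under eq_Rintegral do rewrite -E.
rewrite (tensor_Rintegral iI iF); congr (_ * _).
rewrite /Rintegral integral_indic//= setIT lebesgue_measure_itv/= lte_fin.
by case: ltP => //= ba; rewrite (le_anti (introT andP (conj ab ba))) subrr.
Qed.

Lemma sqint_el_fun e : predictable e -> sqint muP (el_fun e).
Proof.
move=> pe; apply: sqintP; first exact: measurable_el_fun.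
have [+ _] := integral_itv_tensor (el_le pe) (sqint_integrable_sqr (el_sqint pe)).
apply: eq_integrable => // z _; rewrite /= /el_fun exprMn; congr (_ * _)%:E.
by rewrite indicE; case: (_ \in _); rewrite ?expr1n ?expr0n.
Qed.

(** The error in the isometry for a pair of elementary integrands.  It is additive when one
    of the two intervals is cut, which reduces its vanishing to disjoint and to
    equal intervals. *)
Definition el_defect e e' := ip P (el_int e) (el_int e') - ip muP (el_fun e) (el_fun e').

Lemma el_defectC e e' : el_defect e e' = el_defect e' e.
Proof. by rewrite /el_defect (ipC P) (ipC muP). Qed.

Lemma el_defect_split e e' c : predictable e -> predictable e' ->
  el_start e <= c <= el_stop e ->
  [/\ predictable (Elementary (el_coef e) (el_start e) c),
      predictable (Elementary (el_coef e) c (el_stop e)) &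
  el_defect e e' = el_defect (Elementary (el_coef e) (el_start e) c) e' +
                   el_defect (Elementary (el_coef e) c (el_stop e)) e'].
Proof.
move=> pe pe' /andP[ac cb]; have [a0 ab ma bnd] := pe.
set e1 := Elementary _ _ c; set e2 := Elementary _ c _.
have p1 : predictable e1 by split.
have p2 : predictable e2.
  split => //; first exact: le_trans ac.
  exact: (measurable_wrt_homo hF a0 ac).
split => //.
have J : el_int e = fun w => el_int e1 w + el_int e2 w.
  by apply/funext => w; rewrite /el_int /increment /=; ring.
have E : el_fun e = fun z => el_fun e1 z + el_fun e2 z.
  apply/funext => z; rewrite /el_fun /= -mulrDr; congr (_ * _).
  rewrite !indicE !mem_setE !in_itv/=.
  case: (ltP (el_start e) z.1) => h1; case: (leP z.1 c) => h2;
   case: (ltP c z.1) => h3; case: (leP z.1 (el_stop e)) => h4 /=; rewrite ?addr0 ?add0r //; exfalso; lra.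
rewrite /el_defect E J.
rewrite (ipDl (sqint_el_int p1) (sqint_el_int p2) (sqint_el_int pe')).
rewrite (ipDl (sqint_el_fun p1) (sqint_el_fun p2) (sqint_el_fun pe')).
ring.
Qed.

(** Everything but the later increment is measurable at the start of the later interval,
    and that increment has mean zero given this past. *)
Lemma el_defect_disjoint e e' : predictable e -> predictable e' ->
  el_stop e <= el_start e' -> el_defect e e' = 0.
Proof.
move=> pe pe' bc; have [a0 ab ma [M hM]] := pe; have [c0 cd mc [M' hM']] := pe'.
rewrite /el_defect.
have -> : ip muP (el_fun e) (el_fun e') = 0.
  rewrite /ip (_ : (fun _ => _) = fun=> 0) ?Rintegral_cst ?mul0r//.
  apply/funext => z; rewrite /el_fun !indicE !mem_setE !in_itv/=.
  case: (leP z.1 (el_stop e)) => h1; case: (ltP (el_start e') z.1) => h2;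
    rewrite ?andbF/= ?mulr0 ?mul0r//; exfalso; lra.
rewrite subr0 /ip.
have b0 := le_trans a0 ab.
have mZ : measurable_wrt (F (el_start e')) (fun w => el_int e w * el_coef e' w).
  apply: (measurable_wrtM hF) => //.
  apply: (measurable_wrt_homo hF b0 bc); apply: (measurable_wrtM hF) => //.
    exact: (measurable_wrt_homo hF a0 ab).
  exact: (measurable_increment hF hW a0 ab).
have iZ := sqint_integrableM (sqint_el_int pe) (el_sqint pe').
rewrite -(increment_mean hF hW c0 cd mZ iZ).
by apply: eq_Rintegral => w _; rewrite /el_int; ring.
Qed.

(** On a common interval the isometry is the variance of the increment. *)
Lemma el_defect_diag f g a b : predictable (Elementary f a b) ->
  predictable (Elementary g a b) ->
  el_defect (Elementary f a b) (Elementary g a b) = 0.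
Proof.
move=> pf pg; have [/= a0 ab ma [M hM]] := pf; have [/= _ _ mc [M' hM']] := pg.
rewrite /el_defect /ip /el_int /el_fun /=.
have ifg := sqint_integrableM (el_sqint pf) (el_sqint pg).
have [_ EJ] := increment_sqr hF hW a0 ab (measurable_wrtM hF a0 ma mc) ifg.
have [_ EI] := integral_itv_tensor ab ifg.
rewrite [X in _ - X](_ : _ = \int[muP]_z (f z.2 * g z.2 * \1_`]a, b] z.1)); last first.
  apply: eq_Rintegral => z _; rewrite indicE.
  by case: (_ \in _); rewrite ?mulr1// !mulr0.
rewrite [X in X - _](_ : _ = \int[P]_w (f w * g w * increment W a b w ^+ 2)); last first.
  by apply: eq_Rintegral => w _; ring.
by rewrite EI EJ mulrC subrr.
Qed.

(** Order the two intervals by their starting points, cut the first one at the start of the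
    second, then cut the longer of the two remaining ones. *)
Lemma el_defect0 e e' : predictable e -> predictable e' -> el_defect e e' = 0.
Proof.
wlog ac : e e' / el_start e <= el_start e'.
  move=> h pe pe'; have [|/ltW] := leP (el_start e) (el_start e') => [ac|]; first exact: h.
  by move=> ca; rewrite el_defectC; exact: h.
move=> pe pe'; have [|/ltW cb] := leP (el_stop e) (el_start e').
  exact: el_defect_disjoint.
have [|p1 p2 ->] := @el_defect_split e e' (el_start e') pe pe'; first by rewrite ac.
rewrite el_defect_disjoint//= add0r.
move: {e pe ac cb p1} (el_coef e) (el_stop e) p2 => f b pf.
(* both intervals now start at the same time; make the first the shorter *)
wlog bb : f b e' pf pe' / b <= el_stop e'.
  move=> h; have [|/ltW b'b] := leP b (el_stop e'); first exact: h.
  case: e' pf pe' h b'b => g c b' /= pf pg h b'b.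
  by rewrite el_defectC; exact: (h g b' (Elementary f c b)).
case: e' pf pe' bb => g c b' /= pf pg bb.
rewrite el_defectC.
have [|p1 p2 ->] := @el_defect_split (Elementary g c b') (Elementary f c b) b pg pf.
  by rewrite bb andbT; exact: (el_le pf).
by rewrite el_defect_diag// add0r el_defectC el_defect_disjoint.
Qed.

End ElementaryIntegrals.

(** * The Ito integral as an L2 limit *)

Section ItoIntegral.
Context {R : realType} {d : measure_display} {Omega : measurableType d}.
Variables (P : probability Omega R) (F : R -> set (set Omega)).
Variables (W : R -> Omega -> R).
Hypotheses (hF : complete_filtration P F) (hW : brownian_motion P F W).
Notation mu := (@lebesgue_measure R).
Notation muP := (mu \x P)%E.
Notation elementary := (@elementary R d Omega).
Notation predictable := (@predictable R d Omega F).

Definition els_fun n (e : nat -> elementary) (z : measurableTypeR R * Omega) : R :=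
  \sum_(k < n) el_fun (e k) z.

Definition els_int n (e : nat -> elementary) (w : Omega) : R :=
  \sum_(k < n) el_int W (e k) w.

Definition predictables n (e : nat -> elementary) :=
  forall k, (k < n)%N -> predictable (e k).

Lemma sqint_els_fun n e : predictables n e -> sqint muP (els_fun n e).
Proof. by move=> pe; apply: sqint_sum => k; apply: (sqint_el_fun hF); exact: pe. Qed.

Lemma sqint_els_int n e : predictables n e -> sqint P (els_int n e).
Proof. by move=> pe; apply: sqint_sum => k; apply: (sqint_el_int hF hW); exact: pe. Qed.

Lemma els_isometry n e n' e' : predictables n e -> predictables n' e' ->
  ip P (els_int n e) (els_int n' e') = ip muP (els_fun n e) (els_fun n' e').
Proof.
move=> pe pe'.
have se (k : 'I_n) : sqint muP (el_fun (e k)) by apply: (sqint_el_fun hF); exact: pe.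
have se' (k : 'I_n') : sqint muP (el_fun (e' k)) by apply: (sqint_el_fun hF); exact: pe'.
have je (k : 'I_n) : sqint P (el_int W (e k)) by apply: (sqint_el_int hF hW); exact: pe.
have je' (k : 'I_n') : sqint P (el_int W (e' k)) by apply: (sqint_el_int hF hW); exact: pe'.
rewrite /els_int /els_fun (ip_suml _ je (sqint_els_int pe')).
rewrite (ip_suml _ se (sqint_els_fun pe')).
apply: eq_bigr => k _.
rewrite (ipC P) (ip_suml _ je' (je k)) (ipC muP) (ip_suml _ se' (se k)).
apply: eq_bigr => k' _; apply/eqP; rewrite -subr_eq0; apply/eqP.
by apply: (el_defect0 hF hW); [exact: pe'|exact: pe].
Qed.

(** The integrand stopped at time s.  An integrand that starts after s becomes zero on an
    empty interval at s, which keeps it predictable. *)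
Definition el_cut (s : R) (e : elementary) : elementary :=
  Elementary (if el_start e <= s then el_coef e else fun=> 0)
    (Num.min (el_start e) s) (Num.min (el_stop e) s).

Lemma predictable_cut s e : 0 <= s -> predictable e -> predictable (el_cut s e).
Proof.
move=> s0 [a0 ab ma [M hM]]; rewrite /el_cut; have [as_|sa] := leP (el_start e) s.
  split => //=; last by exists M.
  by rewrite le_min ab as_.
split => //=; last by exists 0 => w; rewrite normr0.
- by rewrite le_min lexx (le_trans (ltW sa) ab).
- exact: measurable_wrt_cst hF _ _ s0.
Qed.

Lemma el_fun_cut s e z : el_fun (el_cut s e) z = el_fun e z * (z.1 <= s)%R%:R.
Proof.
rewrite /el_fun /= !indicE !mem_setE !in_itv/=.
case: (leP (el_start e) s) => h1; case: (leP z.1 s) => h2;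
  rewrite /= ?mulr1 ?mulr0 ?mul0r ?lt_min ?le_min ?(h2) ?andbT ?andbF//=.
all: try by rewrite ?(ltNge s) ?(ltW h2) ?(leNgt z.1 s) ?h2 /= ?andbF ?mulr0.
rewrite (_ : el_start e < z.1 = false) ?mulr0//.
by apply/negbTE; rewrite -leNgt (le_trans h2) ?ltW.
Qed.

Lemma els_fun_cut s n e z :
  els_fun n (el_cut s \o e) z = els_fun n e z * (z.1 <= s)%R%:R.
Proof. by rewrite /els_fun mulr_suml; apply: eq_bigr => k _; exact: el_fun_cut. Qed.

(** Increments after s are orthogonal to square-integrable functions of the past of s, so
    that cutting at s is not seen from that past. *)
Lemma ip_el_int_cut s e (Y : Omega -> R) : 0 <= s -> predictable e ->
  measurable_wrt (F s) Y -> sqint P Y ->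
  ip P Y (el_int W e) = ip P Y (el_int W (el_cut s e)).
Proof.
move=> s0 pe mY sY; have [a0 ab ma [M hM]] := pe; have sc := el_sqint hF pe.
rewrite /el_cut; have [as_|sa] := leP (el_start e) s; last first.
  rewrite [RHS](_ : _ = 0).
    rewrite -(increment_mean hF hW a0 ab
      (measurable_wrtM hF a0 (measurable_wrt_homo hF s0 (ltW sa) mY) ma)
      (sqint_integrableM sY sc)).
    by apply: eq_Rintegral => w _; rewrite /el_int mulrA.
  rewrite (_ : el_int _ _ = fun=> 0) ?(ipC P Y) ?ip0l//.
  by apply/funext => w; rewrite /el_int/= mul0r.
have [bs|/ltW sb] := leP (el_stop e) s; first by case: e {pe ab ma hM sc as_ bs a0}.
have pc : predictable (Elementary (el_coef e) (el_start e) s).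
  by split => //; exists M.
have md : measurable_wrt (F s) (el_coef e) by exact: (measurable_wrt_homo hF a0).
have sd : sqint P (fun w => el_coef e w * increment W s (el_stop e) w).
  exact: (sqint_increment hF hW).
rewrite (_ : el_int W e = fun w => el_int W (Elementary (el_coef e) (el_start e) s) w +
   el_coef e w * increment W s (el_stop e) w); last first.
  by apply/funext => w; rewrite /el_int /increment/=; ring.
rewrite (ipDr (sqint_el_int hF hW pc) sd sY) [X in _ + X](_ : _ = 0) ?addr0//.
rewrite -(increment_mean hF hW s0 sb (measurable_wrtM hF s0 mY md) (sqint_integrableM sY sc)).
by apply: eq_Rintegral => w _; rewrite mulrA.
Qed.

Lemma ip_els_int_cut s n e (Y : Omega -> R) : 0 <= s -> predictables n e ->
  measurable_wrt (F s) Y -> sqint P Y ->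
  ip P Y (els_int n e) = ip P Y (els_int n (el_cut s \o e)).
Proof.
move=> s0 pe mY sY.
have je (k : 'I_n) : sqint P (el_int W (e k)) by apply: (sqint_el_int hF hW); exact: pe.
have jc (k : 'I_n) : sqint P (el_int W (el_cut s (e k))).
  by apply: (sqint_el_int hF hW); apply: predictable_cut => //; exact: pe.
rewrite ipC (ip_suml _ je sY) [in RHS]ipC (ip_suml _ jc sY).
by apply: eq_bigr => k _; rewrite !(ipC P _ Y) (ip_el_int_cut s0)//; exact: pe.
Qed.

Notation simple_process := (@simple_process R d Omega).

(** A simple process as a family of elementary integrands; then [els_fun] and [els_int] are
    [sp_fun] and [sp_integral]. *)
Definition els_of_simple (phi : simple_process) (k : nat) : elementary :=
  Elementary (sp_coef phi k) (sp_grid phi k) (sp_grid phi k.+1).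

Lemma simple_grid_le T (phi : simple_process) i j : is_simple_process F T phi ->
  (i <= j <= sp_size phi)%N -> sp_grid phi i <= sp_grid phi j.
Proof.
move=> hphi /andP[]; elim: j => [|j IH]; first by rewrite leqn0 => /eqP->.
rewrite leq_eqVlt => /predU1P[->//|]; rewrite ltnS => ij jn.
by apply: le_trans (sp_homo hphi jn); apply: IH => //; exact: ltnW.
Qed.

Lemma simple_grid_itv T (phi : simple_process) k : is_simple_process F T phi ->
  (k <= sp_size phi)%N -> 0 <= sp_grid phi k <= T.
Proof.
move=> hphi kn; rewrite -(sp_first hphi) -(sp_last hphi).
by rewrite !(simple_grid_le hphi) ?kn ?leqnn.
Qed.

Lemma predictables_simple T (phi : simple_process) : is_simple_process F T phi ->
  predictables (sp_size phi) (els_of_simple phi).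
Proof.
move=> hphi k kn; split => /=.
- by have /andP[] := simple_grid_itv hphi (ltnW kn).
- exact: (sp_homo hphi).
- exact: (sp_adapted hphi).
- by have [M hM] := sp_bounded hphi; exists M => w; exact: hM.
Qed.

Lemma sp_fun_out T (phi : simple_process) s w : is_simple_process F T phi ->
  ~~ (0 <= s <= T) -> sp_fun phi s w = 0.
Proof.
move=> hphi sT; rewrite /sp_fun big1// => k _.
rewrite indicE mem_setE in_itv/=; case: andP => [[h1 h2]|]; last by rewrite mulr0.
move: sT; have /andP[k0 _] := simple_grid_itv hphi (ltnW (ltn_ord k)).
have /andP[_ kT] := simple_grid_itv hphi (ltn_ord k).
by rewrite (le_trans k0 (ltW h1)) (le_trans h2 kT).
Qed.

(** Restricting a process to [0, T] turns all mean-square quantities on [0, T] x Omega into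
    inner products on one measure space, so that different horizons can be compared. *)
Definition trunc (T : R) (H : R -> Omega -> R) (z : measurableTypeR R * Omega) : R :=
  H z.1 z.2 * \1_`[0, T] z.1.

Lemma measurable_trunc T H : ito_integrand P F T H -> measurable_fun setT (trunc T H).
Proof.
move=> hH; have mH := ito_measurable hH.
have mD : measurable (`[0, T]%classic `*` setT : set (measurableTypeR R * Omega)).
  by apply: measurableX => //; exact: measurable_itv.
rewrite (_ : trunc T H = (fun z => H z.1 z.2) \_ (`[0, T]%classic `*` setT)).
  exact/(measurable_restrictT _ mD).
apply/funext => z; rewrite patchE /trunc indicE in_setX in_setT andbT.
by case: (z.1 \in _); rewrite ?mulr1 ?mulr0.
Qed.

(** Square integrability and convergence of integrands are given by iterated integrals, inner
    products by the product measure. *)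
Lemma integral_trunc T (f : measurableTypeR R * Omega -> R) :
  measurable_fun setT f -> (forall z, 0 <= f z) ->
  (forall s w, ~~ (0 <= s <= T) -> f (s, w) = 0) ->
  (\int[P]_w \int[mu]_(s in `[0%R, T]) (f (s, w))%:E = \int[muP]_z (f z)%:E)%E.
Proof.
move=> mf f0 fT.
have mfE : measurable_fun setT (EFin \o f) by exact/measurable_EFinP.
have fE0 z : (0 <= (EFin \o f) z)%E by rewrite lee_fin.
rewrite [RHS](@fubini_tonelli2 _ _ _ _ _ mu P (EFin \o f) mfE fE0).
apply: eq_integral => w _; rewrite /fubini_G [LHS]integral_mkcond; apply: eq_integral => s _.
rewrite patchE mem_setE in_itv/=; case: ifPn => // h.
by rewrite /= fT.
Qed.

Lemma sqint_trunc T H : ito_integrand P F T H -> sqint muP (trunc T H).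
Proof.
move=> hH; split; first exact: measurable_trunc.
rewrite -(@integral_trunc T (fun z => trunc T H z ^+ 2)).
- apply: le_lt_trans (ito_square_integrable hH).
  rewrite le_eqVlt; apply/orP; left; apply/eqP.
  apply: eq_integral => w _; apply: eq_integral => s sT.
  by rewrite /trunc/= indicE sT mulr1.
- by apply: measurable_funX; exact: measurable_trunc.
- by move=> z; rewrite sqr_ge0.
- move=> s w sT; rewrite /trunc/= indicE mem_setE in_itv/= (negbTE sT).
  by rewrite mulr0 expr0n.
Qed.

Lemma ito_cvg2 T H I : ito_integral P F W T H I ->
  exists n : nat -> nat, exists e : nat -> nat -> elementary,
  [/\ forall k, predictables (n k) (e k),
      cvg2 P (fun k => els_int (n k) (e k)) I &
      cvg2 muP (fun k => els_fun (n k) (e k)) (trunc T H)].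
Proof.
move=> [hH mI [phi [hphi cH cI]]].
exists (fun k => sp_size (phi k)), (fun k => els_of_simple (phi k)).
have pphi k := predictables_simple (hphi k).
split => //.
  by apply: cvg2_of_ereal => // k; exact: sqint_els_int.
apply: cvg2_of_ereal => [|k|]; first exact: measurable_trunc.
  exact: sqint_els_fun.
apply: cvg_trans cH; apply: near_eq_cvg; apply: nearW => k /=.
rewrite -(@integral_trunc T (fun z => (trunc T H z - els_fun _ _ z) ^+ 2)).
- apply: eq_integral => w _; apply: eq_integral => s sT.
  by rewrite /trunc/= indicE sT mulr1.
- apply: measurable_funX; apply: measurable_funB; first exact: measurable_trunc.
  by case: (sqint_els_fun (pphi k)).
- by move=> z; rewrite sqr_ge0.
- move=> s w sT; rewrite /trunc/= indicE mem_setE in_itv/= (negbTE sT) mulr0.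
  by rewrite -[els_fun _ _ _]/(sp_fun (phi k) s w) (sp_fun_out _ (hphi k) sT) subrr expr0n.
Qed.

Lemma ito_sqint T H I : ito_integral P F W T H I -> sqint P I.
Proof. by move=> /ito_cvg2[n [e [_ [_ ? _] _]]]. Qed.

(** The elementary isometry passes to the limit because inner products are continuous.  With
    different horizons it also says that an Ito integral has the same inner product with later and with
    present values of another one. *)
Theorem ito_isometry S H I T H' I' :
  ito_integral P F W S H I -> ito_integral P F W T H' I' ->
  ip P I I' = ip muP (trunc S H) (trunc T H').
Proof.
move=> /ito_cvg2[n [e [pe cI cH]]] /ito_cvg2[n' [e' [pe' cI' cH']]].
have c1 := cvg2_ip cI cI'; have c2 := cvg2_ip cH cH'.
apply: (cvg_unique _ c1); first exact: Rhausdorff.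
apply: cvg_trans c2; apply: near_eq_cvg; apply: nearW => k /=.
exact/esym/els_isometry.
Qed.

(** Cut at s the approximations of the integral up to t: seen from the past of s nothing
    changes, and by the isometry the cut approximations converge to the integral up
    to s. *)
Theorem ito_martingale s t H I J (Y : Omega -> R) : 0 <= s -> s <= t ->
  ito_integral P F W s H I -> ito_integral P F W t H J ->
  measurable_wrt (F s) Y -> sqint P Y ->
  ip P Y J = ip P Y I.
Proof.
move=> s0 st hI hJ mY sY.
have iH : ito_integrand P F s H by case: hI.
have /ito_cvg2[n [e [pe cI cH]]] := hI; have /ito_cvg2[n' [e' [pe' cJ cH']]] := hJ.
have pc k : predictables (n' k) (el_cut s \o e' k).
  by move=> j jn; apply: predictable_cut => //; exact: pe'.
(* truncation to [0, s] does not increase the distance in mean square *)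
have cF : cvg2 muP (fun k => els_fun (n' k) (el_cut s \o e' k)) (trunc s H).
  split => [k||]; [exact: sqint_els_fun|exact: sqint_trunc|].
  have [_ _ c0] := cH'.
  apply: (squeeze_cvgr _ (cvg_cst 0) c0); apply: nearW => k; rewrite ip_ge0/=.
  have sd : sqint muP (fun z => trunc t H z - els_fun (n' k) (e' k) z).
    by apply: sqintB; [apply: sqint_trunc; case: hJ|exact: sqint_els_fun].
  have sc : sqint muP (fun z => trunc s H z - els_fun (n' k) (el_cut s \o e' k) z).
    by apply: sqintB; [exact: sqint_trunc|exact: sqint_els_fun].
  apply: le_Rintegral => //; [exact: sqint_integrableM..|].
  move=> z _; rewrite -!expr2 els_fun_cut.
  rewrite [trunc s H z](_ : _ = trunc t H z * (z.1 <= s)%R%:R).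
    rewrite -mulrBl exprMn; case: (_ <= s); first by rewrite expr1n mulr1.
    by rewrite expr0n mulr0 sqr_ge0.
  rewrite /trunc -mulrA; congr (_ * _); rewrite !indicE !mem_setE !in_itv/=.
  case: (0 <= z.1); rewrite ?mul0r//=; case: (leP z.1 s) => h; rewrite ?mulr0 ?mulr1//.
  by rewrite (le_trans h st).
have cI' : cvg2 P (fun k => els_int (n' k) (el_cut s \o e' k)) I.
  apply: (cvg2_near cI) => [k|]; first exact: sqint_els_int.
  have := cvg2_dist cH cF.
  apply: cvg_trans; apply: near_eq_cvg; apply: nearW => k /=.
  have p1 := pe k; have p2 := pc k.
  rewrite !(ipBl, ipBr) ?els_isometry//; try exact: sqint_els_int; try exact: sqint_els_fun;
    try (apply: sqintB; exact: sqint_els_int); apply: sqintB; exact: sqint_els_fun.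
have c1 := cvg2_ip (cvg2_cst sY) cI'; have c2 := cvg2_ip (cvg2_cst sY) cJ.
apply: (cvg_unique _ c2); first exact: Rhausdorff.
apply: cvg_trans c1; apply: near_eq_cvg; apply: nearW => k /=.
exact/esym/ip_els_int_cut.
Qed.

End ItoIntegral.

(** * Time slices and primitives of processes *)

Section TimeSlices.
Context {R : realType} {d : measure_display} {Omega : measurableType d}.
Variable (P : probability Omega R).
Notation mu := (@lebesgue_measure R).
Notation muP := (mu \x P)%E.
Implicit Types (H : R -> Omega -> R) (Z : Omega -> R) (T : R).

Lemma integrable_itv_mkcond (T : R) (f : R -> R) :
  mu.-integrable setT (EFin \o (f \_ `[0, T])) -> mu.-integrable `[0, T] (EFin \o f).
Proof.
by move=> h; apply/(integrable_mkcond _ _).2 => //; move: h; rewrite restrict_EFin.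
Qed.

Lemma trunc_slice T H H' s :
  \int[P]_w (trunc T H (s, w) * trunc T H' (s, w)) =
  ((fun s => ip P (H s) (H' s)) \_ `[0, T]) s.
Proof.
rewrite patchE; case: ifPn => sT; last first.
  rewrite (_ : (fun _ => _) = fun=> 0) ?Rintegral_cst ?mul0r//.
  by apply/funext => w; rewrite /trunc/= indicE (negbTE sT) !mulr0.
by apply: eq_Rintegral => w _; rewrite /trunc/= indicE sT !mulr1.
Qed.

Lemma slices_integrableT T H H' : sqint muP (trunc T H) -> sqint muP (trunc T H') ->
  mu.-integrable setT (EFin \o ((fun s => ip P (H s) (H' s)) \_ `[0, T])).
Proof.
move=> sH sH'; have := Rfubini_integrable1 (sqint_integrableM sH sH').
by apply: eq_integrable => // s _; rewrite /= trunc_slice.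
Qed.

Lemma slices_integrable T H H' : sqint muP (trunc T H) -> sqint muP (trunc T H') ->
  mu.-integrable `[0, T] (EFin \o (fun s => ip P (H s) (H' s))).
Proof.
by move=> sH sH'; apply: integrable_itv_mkcond; exact: slices_integrableT.
Qed.

Lemma ip_slices T H H' : sqint muP (trunc T H) -> sqint muP (trunc T H') ->
  ip muP (trunc T H) (trunc T H') = \int[mu]_(s in `[0, T]) ip P (H s) (H' s).
Proof.
move=> sH sH'; rewrite /ip (Rfubini1 (sqint_integrableM sH sH')).
rewrite [RHS]Rintegral_mkcond; apply: eq_Rintegral => s _.
exact: trunc_slice.
Qed.

Lemma sqint_trunc_cst T Z : sqint P Z -> sqint muP (trunc T (fun=> Z)).
Proof.
move=> sZ; have mZ : measurable_fun setT Z by case: sZ.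
have mt : measurable_fun setT (trunc T (fun=> Z)).
  apply: measurable_funM; first exact: (measurableT_comp mZ).
  exact: (measurableT_comp (f := \1_`[0, T] : measurableTypeR R -> R)).
split => //; rewrite -(@integral_trunc _ _ _ P T (fun z => trunc T (fun=> Z) z ^+ 2)).
- rewrite (_ : (\int[P]_w _)%E = (\int[P]_w ((Z w ^+ 2)%:E * mu `[0%R, T]))%E); last first.
    apply: eq_integral => w _; rewrite -integral_cst//.
    by apply: eq_integral => s sT; rewrite /trunc/= indicE sT mulr1.
  rewrite ge0_integralZr//; last 2 first.
  - by apply/measurable_EFinP; exact: measurable_funX.
  - by move=> w _; rewrite lee_fin sqr_ge0.
  rewrite lte_mul_pinfty//.
  - by apply: integral_ge0 => w _; rewrite lee_fin sqr_ge0.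
  - rewrite ge0_fin_numE; first by case: sZ.
    by apply: integral_ge0 => w _; rewrite lee_fin sqr_ge0.
  - by rewrite /= lebesgue_measure_itv/=; case: ifP => _; rewrite -?EFinB ltry.
- exact: measurable_funX.
- by move=> z; rewrite sqr_ge0.
- by move=> s w sT; rewrite /trunc/= indicE mem_setE in_itv/= (negbTE sT) mulr0 expr0n.
Qed.

Definition primitive (g : R -> Omega -> R) (T : R) (w : Omega) : R :=
  \int[mu]_(s in `[0, T]) g s w.

Section primitive.
Variables (g : R -> Omega -> R) (T : R).
Hypothesis sg : sqint muP (trunc T g).

Let primitiveE w : primitive g T w = \int[mu]_s trunc T g (s, w).
Proof.
rewrite /primitive Rintegral_mkcond; apply: eq_Rintegral => s _.
by rewrite patchE /trunc/= indicE; case: (_ \in _); rewrite ?mulr1 ?mulr0.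
Qed.

Let trunc_integrable : muP.-integrable setT (EFin \o trunc T g).
Proof.
have := sqint_integrableM sg (sqint_trunc_cst T (sqint_cst P 1)).
apply: eq_integrable => // z _ /=; rewrite /trunc mul1r.
by rewrite indicE; case: (_ \in _); rewrite !(mulr1, mulr0).
Qed.

Lemma measurable_primitive : measurable_fun setT (primitive g T).
Proof.
have := Rfubini_integrable2 trunc_integrable => /measurable_int/measurable_EFinP.
by under eq_fun do rewrite -primitiveE.
Qed.

(** Fubini: the expectation of Z times a time integral is the time integral of the
    expectations. *)
Lemma ip_primitive Z : sqint P Z ->
  ip P (primitive g T) Z = ip muP (trunc T g) (trunc T (fun=> Z)).
Proof.
move=> sZ; have sZT := sqint_trunc_cst T sZ.
have iM := sqint_integrableM sg sZT.
rewrite /ip (Rfubini2 iM); congr fine.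
apply: ae_eq_integral => //.
- apply/measurable_EFinP; apply: measurable_funM; first exact: measurable_primitive.
  by case: sZ.
- by have /measurable_int := Rfubini_integrable2 iM.
have := ae_integrable2 trunc_integrable; apply: filterS => w hw _.
rewrite primitiveE -RintegralZr//; congr EFin; apply: eq_Rintegral => s _.
by rewrite /trunc /= indicE; case: (_ \in _); rewrite !(mulr1, mulr0, mul0r).
Qed.

(** By Cauchy-Schwarz in time, the square of the primitive is at most T times the integral of
    the square; T + 1 also bounds the case of an infinite right-hand side when T = 0. *)
Lemma sqint_primitive : sqint P (primitive g T).
Proof.
split; first exact: measurable_primitive.
pose c := fine (mu `[0, T]).
have c0 : 0 <= c by rewrite fine_ge0.
have mTg : measurable_fun setT (trunc T g) by case: sg.
have m2 : measurable_fun setT (fun z => (trunc T g z ^+ 2)%:E).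
  by apply/measurable_EFinP; exact: measurable_funX.
apply: (@le_lt_trans _ _
    (\int[P]_w ((c + 1)%:E * \int[mu]_s (trunc T g (s, w) ^+ 2)%:E))%E); last first.
  rewrite ge0_integralZl//; last 3 first.
  - apply: (@measurable_fun_fubini_tonelli_G _ _ _ _ _ mu
      (fun z => (trunc T g z ^+ 2)%:E)) => // z.
    by rewrite lee_fin sqr_ge0.
  - by move=> w _; apply: integral_ge0 => s _; rewrite lee_fin sqr_ge0.
  - by rewrite lee_fin addr_ge0.
  rewrite -(@fubini_tonelli2 _ _ _ _ _ mu P (fun z => (trunc T g z ^+ 2)%:E))//; last first.
    by move=> z; rewrite lee_fin sqr_ge0.
  case: sg => _ lt2; rewrite lte_mul_pinfty// ?lee_fin ?addr_ge0//.
apply: ge0_le_integral => //.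
- by move=> w _; rewrite lee_fin sqr_ge0.
- by apply/measurable_EFinP/measurable_funX; exact: measurable_primitive.
- apply: measurable_funeM.
  apply: (@measurable_fun_fubini_tonelli_G _ _ _ _ _ mu
      (fun z => (trunc T g z ^+ 2)%:E)) => // z.
  by rewrite lee_fin sqr_ge0.
move=> w _.
have [->|finw] := eqVneq (\int[mu]_s (trunc T g (s, w) ^+ 2)%:E)%E +oo%E.
  by rewrite gt0_muley ?leey// lte_fin ltr_wpDl.
have sgw : sqint mu (fun s => trunc T g (s, w)).
  split; first exact: (measurableT_comp mTg).
  by rewrite ltey.
have s1 : sqint mu (fun s : measurableTypeR R => \1_`[0, T] s).
  split; first exact: measurable_indic.
  rewrite (_ : (\int[mu]_x _)%E = (\int[mu]_x (\1_`[0, T] x)%:E)%E); last first.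
    by apply: eq_integral => s _; rewrite indicE; case: (_ \in _); rewrite ?expr1n ?expr0n.
  rewrite integral_indic// setIT /= lebesgue_measure_itv/=.
  by case: ifP => _; rewrite -?EFinB ltry.
have := ip_CS sgw s1.
rewrite {1}/ip (_ : \int[mu]_x (trunc T g (x, w) * _) = primitive g T w); last first.
  rewrite primitiveE; apply: eq_Rintegral => s _; rewrite /trunc/= indicE.
  by case: (_ \in _); rewrite !(mulr1, mulr0).
rewrite -lee_fin => /le_trans; apply.
have -> : ip mu (fun s : measurableTypeR R => \1_`[0, T] s)
    (fun s : measurableTypeR R => \1_`[0, T] s) = c.
  rewrite /ip /c /Rintegral -[X in _ = fine (_ X)]setIT -integral_indic//; congr fine.
  by apply: eq_integral => s _; rewrite indicE; case: (_ \in _); rewrite !(mulr1, mulr0).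
have -> : (\int[mu]_s (trunc T g (s, w) ^+ 2)%:E)%E =
    (ip mu (fun s => trunc T g (s, w)) (fun s => trunc T g (s, w)))%:E.
  rewrite /ip /Rintegral; under [in RHS]eq_integral do rewrite -expr2.
  rewrite fineK// ge0_fin_numE ?ltey//; apply: integral_ge0 => s _.
  by rewrite lee_fin sqr_ge0.
by rewrite -EFinM lee_fin mulrC ler_wpM2r ?ip_ge0// lerDl.
Qed.

End primitive.
End TimeSlices.

(** * The product rule in expectation *)

Section ProductRule.
Context {R : realType} {d : measure_display} {Omega : measurableType d}.
Variables (P : probability Omega R) (F : R -> set (set Omega)).
Variables (W : R -> Omega -> R).
Hypotheses (hF : complete_filtration P F) (hW : brownian_motion P F W).
Notation mu := (@lebesgue_measure R).
Notation muP := (mu \x P)%E.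
Notation cross T H H' := (ip muP (trunc T H) (trunc T H')).

Lemma ito_integral_ae T H I I' : measurable_fun setT I' ->
  {ae P, forall w, I' w = I w} ->
  ito_integral P F W T H I -> ito_integral P F W T H I'.
Proof.
move=> mI' II' [hH mI [phi [hphi cH cI]]]; split=> //; exists phi; split=> //.
apply: cvg_trans cI; apply: near_eq_cvg; apply: nearW => k /=.
have mJ : measurable_fun setT (sp_integral W (phi k)).
  by case: (sqint_els_int hF hW (predictables_simple (hphi k))).
apply: ae_eq_integral => //.
- by apply/measurable_EFinP/measurable_funX; exact: measurable_funB.
- by apply/measurable_EFinP/measurable_funX; exact: measurable_funB.
- by apply: filterS II' => w -> _.
Qed.

Record ito_process (u : R) (g K U : R -> Omega -> R) : Prop := {
  itop_drift : forall T, 0 <= T -> ito_integrand P F T g ;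
  itop_state : forall T, 0 <= T -> ito_integrand P F T U ;
  itop_eq : forall t, 0 <= t -> exists2 I, ito_integral P F W t K I &
    {ae P, forall w, U t w = u + primitive g t w + I w} }.

Definition noise (u : R) (g U : R -> Omega -> R) (t : R) (w : Omega) : R :=
  U t w - u - primitive g t w.

Section OneProcess.
Variables (u : R) (g K U : R -> Omega -> R).
Hypothesis hU : ito_process u g K U.

(** The Ito integral in the equation is only determined almost surely and is chosen separately
    for each time; the noise is the version of it that the process itself determines. *)
Lemma noise_ito t : 0 <= t -> ito_integral P F W t K (noise u g U t).
Proof.
move=> t0; have [I hI UE] := itop_eq hU t0.
apply: ito_integral_ae hI.
  apply: measurable_funB; last first.
    apply: measurable_primitive; apply: sqint_trunc; exact: (itop_drift hU).
  apply: measurable_funB => //.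
  apply: (measurable_wrt_fun hF t0).
  exact: (ito_adapted (itop_state hU t0)).
by apply: filterS UE => w; rewrite /noise => ->; ring.
Qed.

Lemma sqint_drift t : 0 <= t -> sqint muP (trunc t g).
Proof. by move=> t0; apply: sqint_trunc; exact: (itop_drift hU). Qed.

Lemma sqint_path t : 0 <= t -> sqint muP (trunc t U).
Proof. by move=> t0; apply: sqint_trunc; exact: (itop_state hU). Qed.

Lemma sqint_noise t : 0 <= t -> sqint P (noise u g U t).
Proof. by move=> /noise_ito; exact: ito_sqint. Qed.

Lemma sqint_state t : 0 <= t -> sqint P (U t).
Proof.
move=> t0; rewrite (_ : U t = fun w => (u + primitive g t w) + noise u g U t w).
  apply: sqintD; last exact: sqint_noise.
  apply: sqintD; first exact: sqint_cst.
  exact: sqint_primitive (sqint_drift t0).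
by apply/funext => w; rewrite /noise; ring.
Qed.

(** At time 0 the noise vanishes by the isometry, and later increments have mean zero. *)
Lemma noise_mean t : 0 <= t -> ip P (fun=> 1) (noise u g U t) = 0.
Proof.
move=> t0; have h0 := noise_ito (lexx 0).
rewrite (ito_martingale hF hW (lexx 0) t0 h0 (noise_ito t0) _ (sqint_cst P 1)); last first.
  exact: measurable_wrt_cst hF _ _ (lexx 0).
have [iK _ _] := h0.
have i0 : ip P (noise u g U 0) (noise u g U 0) = 0.
  rewrite (ito_isometry hF hW h0 h0) ip_slices; [|exact: (sqint_trunc iK)..].
  by rewrite set_itv1 Rintegral_set1.
apply/eqP; rewrite -sqrf_eq0; apply/eqP/le_anti; rewrite sqr_ge0 andbT.
by apply: le_trans (ip_CS (sqint_cst P 1) (sqint_noise (lexx 0))) _; rewrite i0 mulr0.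
Qed.

End OneProcess.

Let kernel T (g h : R -> Omega -> R) (z : measurableTypeR R * measurableTypeR R) : R :=
  \int[P]_w (trunc T g (z.1, w) * trunc T h (z.2, w)).

Let kernelE T g h s r : kernel T g h (s, r) =
  if (s \in `[0, T]) && (r \in `[0, T]) then ip P (g s) (h r) else 0.
Proof.
rewrite /kernel; case: ifPn => [/andP[sT rT]|].
  by apply: eq_Rintegral => w _; rewrite /trunc/= !indicE !mem_setE sT rT !mulr1.
rewrite negb_and => /orP H; rewrite (_ : (fun _ => _) = fun=> 0) ?Rintegral_cst ?mul0r//.
apply/funext => w; rewrite /trunc/= !indicE !mem_setE.
by case: H => /negbTE ->; rewrite ?mulr0 ?mul0r.
Qed.

Let kernel_integrable T g h : sqint muP (trunc T g) -> sqint muP (trunc T h) ->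
  (forall t, 0 <= t -> sqint P (g t)) -> (forall t, 0 <= t -> sqint P (h t)) ->
  (mu \x mu)%E.-integrable setT (EFin \o kernel T g h).
Proof.
move=> sg sh pg ph.
have one : mu.-integrable setT (EFin \o (\1_`[0, T] : R -> R)).
  exact: integrable_indic_itv.
have diag k : sqint muP (trunc T k) ->
    mu.-integrable setT (EFin \o ((fun s => ip P (k s) (k s)) \_ `[0, T])).
  by move=> sk; exact: slices_integrableT.
have := integrableD measurableT (tensor_integrable (diag g sg) one)
  (tensor_integrable one (diag h sh)).
apply: le_integrable => //.
  have mg : measurable_fun setT (trunc T g) by case: sg.
  have mh : measurable_fun setT (trunc T h) by case: sh.
  apply/measurable_EFinP.
  pose G (z : (measurableTypeR R * measurableTypeR R) * Omega) :=
    trunc T g (z.1.1, z.2) * trunc T h (z.1.2, z.2).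
  apply: (@measurable_Rintegral_slice _ _ _ _ _ P G).
  apply: measurable_funM.
    apply: (measurableT_comp mg); apply: measurable_fun_pair => //.
    exact: (measurableT_comp measurable_fst).
  apply: (measurableT_comp mh); apply: measurable_fun_pair => //.
  exact: (measurableT_comp measurable_snd).
move=> -[s r] _; rewrite /= kernelE lee_fin !patchE !indicE !mem_setE.
case: (boolP (s \in `[0, T])) => sT /=; last by rewrite normr0 normr_ge0.
case: (boolP (r \in `[0, T])) => rT /=; last by rewrite normr0 normr_ge0.
have [s0 r0] : 0 <= s /\ 0 <= r.
  by move: sT rT; rewrite !in_itv/= => /andP[-> _] /andP[-> _].
have := ip_CS (pg _ s0) (ph _ r0).
have := ip_ge0 P (g s); have := ip_ge0 P (h r).
set x := ip P (g s) (g s); set y := ip P (h r) (h r); set c := ip P _ _.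
move=> y0 x0 cxy; rewrite mulr1 mul1r [leRHS]ger0_norm ?addr_ge0//.
rewrite -(@ler_pXn2r _ 2) ?nnegrE ?addr_ge0// real_normK ?num_real//.
by apply: le_trans cxy _; nra.
Qed.

(** The two primitives multiply to an integral over the square [0, T]^2 of the kernel
    E[g(s) h(r)]; its triangles r <= s and s <= r give the two terms. *)
Lemma ip_primitiveM T g h : (forall t, 0 <= t -> sqint muP (trunc t g)) ->
  (forall t, 0 <= t -> sqint muP (trunc t h)) ->
  (forall t, 0 <= t -> sqint P (g t)) -> (forall t, 0 <= t -> sqint P (h t)) -> 0 <= T ->
  ip P (primitive g T) (primitive h T) =
  \int[mu]_(s in `[0, T]) ip P (g s) (primitive h s) +
  \int[mu]_(s in `[0, T]) ip P (h s) (primitive g s).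
Proof.
move=> sg sh pg ph T0.
have sgT := sg _ T0; have shT := sh _ T0.
have inner t g' Z s : sqint P Z -> sqint muP (trunc t g') -> s \in `[0, T] -> t <= T ->
   ip P Z (primitive g' t) = \int[mu]_(r in `[0, t]) ip P Z (g' r).
  move=> sZ sg' sT tT; rewrite ipC (ip_primitive sg' sZ).
  rewrite (ip_slices sg' (sqint_trunc_cst t sZ)).
  by apply: eq_Rintegral => r _; rewrite ipC.
have kE := kernelE T g h.
have ki := kernel_integrable sgT shT pg ph.
have -> : ip P (primitive g T) (primitive h T) = \int[(mu \x mu)%E]_z kernel T g h z.
  rewrite ip_primitive//; last exact: sqint_primitive.
  rewrite ip_slices//; last by apply/sqint_trunc_cst/sqint_primitive.
  rewrite (Rfubini1 ki) [LHS]Rintegral_mkcond; apply: eq_Rintegral => s _.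
  rewrite patchE mem_setE; case: ifPn => sT; last first.
    rewrite (_ : (fun _ => _) = fun=> 0) ?Rintegral_cst ?mul0r//.
    by apply/funext => r; rewrite kE (negbTE sT).
  have s0 : 0 <= s by move: sT; rewrite in_itv/= => /andP[].
  rewrite (inner _ _ _ s (pg _ s0) shT sT (lexx T)) [LHS]Rintegral_mkcond.
  apply: eq_Rintegral => r _; rewrite patchE mem_setE kE sT/=.
  by case: ifPn.
rewrite (integral_triangles ki); congr (_ + _).
  rewrite [RHS]Rintegral_mkcond; apply: eq_Rintegral => s _.
  rewrite patchE mem_setE; case: ifPn => sT; last first.
    rewrite (_ : (fun _ => _) = fun=> 0) ?Rintegral_cst ?mul0r//.
    by apply/funext => r; rewrite kE (negbTE sT).
  have := sT; rewrite in_itv/= => /andP[s0 sleT].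
  rewrite (inner _ _ _ s (pg _ s0) (sh _ s0) sT sleT) [LHS]Rintegral_mkcond [RHS]Rintegral_mkcond.
  apply: eq_Rintegral => r _; rewrite !patchE !mem_setE kE sT/= !in_itv/=.
  case: (leP r s) => rs; rewrite ?andbF// andbT.
  by rewrite (le_trans rs sleT) andbT.
rewrite [RHS]Rintegral_mkcond; apply: eq_Rintegral => r _.
rewrite patchE mem_setE; case: ifPn => rT; last first.
  rewrite (_ : (fun _ => _) = fun=> 0) ?Rintegral_cst ?mul0r//.
  by apply/funext => s; rewrite kE (negbTE rT) andbF.
have := rT; rewrite in_itv/= => /andP[r0 rleT].
rewrite (inner _ _ _ r (ph _ r0) (sg _ r0) rT rleT) [LHS]Rintegral_mkcond [RHS]Rintegral_mkcond.
apply: eq_Rintegral => s _; rewrite !patchE !mem_setE kE rT/= !in_itv/= andbT ipC.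
case: (leP s r) => sr; rewrite ?andbF// andbT.
by rewrite (le_trans sr rleT) andbT.
Qed.

(** Expand both factors into constant, primitive and noise.  In E[(int g) M(T)], M the noise
    of V, the future M(T) - M(s) is orthogonal to g(s), so M(T) may be replaced by
    M(s) = V(s) - v - int_0^s h; the double integrals that arise cancel by
    [ip_primitiveM]. *)
Theorem product_rule u g K U v h K' V T : 0 <= T ->
  ito_process u g K U -> ito_process v h K' V ->
  (forall t, 0 <= t -> sqint P (g t)) -> (forall t, 0 <= t -> sqint P (h t)) ->
  ip P (U T) (V T) = u * v + cross T g V + cross T U h + cross T K K'.
Proof.
move=> T0 hU hV pg ph.
have sgT := sqint_drift hU T0; have shT := sqint_drift hV T0.
have sUT := sqint_path hU T0; have sVT := sqint_path hV T0.
(* stated for an arbitrary pair of processes: it is used in both orders *)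
have mixed u0 v0 g0 h0 K0 K1 U0 V0 : ito_process u0 g0 K0 U0 -> ito_process v0 h0 K1 V0 ->
  (forall t, 0 <= t -> sqint P (g0 t)) -> (forall t, 0 <= t -> sqint P (h0 t)) ->
  ip P (primitive g0 T) (noise v0 h0 V0 T) =
    cross T g0 V0 - v0 * ip P (primitive g0 T) (fun=> 1) -
    \int[mu]_(s in `[0, T]) ip P (g0 s) (primitive h0 s).
  move=> hU0 hV0 pg0 ph0.
  have sg0 := sqint_drift hU0 T0; have sV0 := sqint_path hV0 T0.
  have sN := sqint_noise hV0 T0.
  have sNT := sqint_trunc_cst T sN; have s1T := sqint_trunc_cst T (sqint_cst P 1).
  rewrite !ip_primitive//; last exact: sqint_cst.
  rewrite !ip_slices//.
  have i1 := slices_integrable sg0 sNT.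
  have i2 := slices_integrable sg0 sV0.
  have i3 := slices_integrable sg0 s1T.
  have E s : s \in `[0, T] -> ip P (g0 s) (primitive h0 s) =
      ip P (g0 s) (V0 s) - v0 * ip P (g0 s) (fun=> 1) - ip P (g0 s) (noise v0 h0 V0 T).
    rewrite in_itv/= => /andP[s0 sT].
    rewrite (ito_martingale hF hW s0 sT (noise_ito hV0 s0) (noise_ito hV0 T0)); last 2 first.
    - exact: (ito_adapted (itop_drift hU0 s0)).
    - exact: pg0.
    have sp := sqint_primitive (sqint_drift hV0 s0).
    have sv : sqint P (fun w => v0 * (fun=> 1) w) by apply/sqintZ/sqint_cst.
    have sV := sqint_state hV0 s0.
    rewrite /noise (ipBr (sqintB sV (sqint_cst P v0)) sp (pg0 _ s0)).
    rewrite (ipBr sV (sqint_cst P v0) (pg0 _ s0)) -(ipZr _ (sqint_cst P 1) (pg0 _ s0)).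
    rewrite (_ : (fun x => v0 * 1) = fun=> v0); first by ring.
    by apply/funext => w; rewrite mulr1.
  have i3v : mu.-integrable `[0, T] (EFin \o (fun s => v0 * ip P (g0 s) (fun=> 1))).
    rewrite (_ : EFin \o _ = fun s => (v0%:E * (ip P (g0 s) (fun=> 1%R))%:E)%E)//.
    exact: integrableZl i3.
  have i23 : mu.-integrable `[0, T]
      (EFin \o (fun s => ip P (g0 s) (V0 s) - v0 * ip P (g0 s) (fun=> 1))).
    exact: (integrableB _ i2 i3v).
  have -> : \int[mu]_(s in `[0, T]) ip P (g0 s) (primitive h0 s) =
      \int[mu]_(s in `[0, T]) (ip P (g0 s) (V0 s) - v0 * ip P (g0 s) (fun=> 1) -
        ip P (g0 s) (noise v0 h0 V0 T)).
    by apply: eq_Rintegral => s sT; apply: E; rewrite mem_setE in sT.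
  rewrite RintegralB//; rewrite RintegralB// RintegralZl//.
  by rewrite opprB addrCA subrr addr0.
have sN := sqint_noise hU T0; have sM := sqint_noise hV T0.
have sa := sqint_primitive sgT; have sb := sqint_primitive shT.
have s1 := sqint_cst P 1.
have decomp (u0 : R) g0 U0 : U0 T = fun w : Omega =>
    u0 * (fun=> 1) w + primitive g0 T w + noise u0 g0 U0 T w.
  by apply/funext => w; rewrite /noise; ring.
have nU := noise_mean hU T0; have nV := noise_mean hV T0.
have aN := mixed _ _ _ _ _ _ _ _ hU hV pg ph.
have bN := mixed _ _ _ _ _ _ _ _ hV hU ph pg.
have NN := ito_isometry hF hW (noise_ito hU T0) (noise_ito hV T0).
have ab := ip_primitiveM (sqint_drift hU) (sqint_drift hV) pg ph T0.
have su : sqint P (fun w => u * (fun=> 1) w) by exact: sqintZ.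
have sv : sqint P (fun w => v * (fun=> 1) w) by exact: sqintZ.
have i11 : ip P (fun=> 1) (fun=> 1) = 1.
  by rewrite /ip /Rintegral integral_cst//= probability_setT mule1/= mulr1.
rewrite (decomp u g U) (decomp v h V).
set a := primitive g T in sa aN bN ab *; set b := primitive h T in sb aN bN ab *.
set N := noise u g U T in sN nU bN NN *; set M := noise v h V T in sM nV aN NN *.
have sV : sqint P (fun w => v * (fun=> 1) w + b w + M w).
  by apply: sqintD => //; exact: sqintD.
have sua : sqint P (fun w => u * (fun=> 1) w + a w) by exact: sqintD.
have svb : sqint P (fun w => v * (fun=> 1) w + b w) by exact: sqintD.
have expand f : sqint P f -> ip P f (fun w => v * (fun=> 1) w + b w + M w) =
    v * ip P f (fun=> 1) + ip P f b + ip P f M.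
  by move=> sf; rewrite ipDr// ipDr// ipZr.
rewrite ipDl// ipDl// ipZl// !expand// NN nV i11 ab aN.
rewrite (ipC P N) nU (ipC P N b) bN (ipC P (fun=> 1) b) (ipC muP (trunc T U)).
move: (ip P a _) (ip P b _) (cross T g V) (cross T h U) (cross T K K').
move: (\int[mu]_(s in `[0, T]) ip P (g s) (primitive h s)).
move: (\int[mu]_(s in `[0, T]) ip P (h s) (primitive g s)) => *.
by ring.
Qed.

End ProductRule.

(** * Riccati algebra *)

(* identities between sums of noncommutative monomials reduce to the additive
   group, hence entrywise to a commutative ring *)
Ltac zmod_mx :=
  repeat match goal with |- context [?X *m ?Y] => move: (X *m Y) => ? end;
  apply/matrixP => ? ?; rewrite !mxE; ring.

Section RiccatiAlgebra.
Context {R : realType}.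

Lemma psdmxD n (M N : 'M[R]_n) : psdmx M -> psdmx N -> psdmx (M + N).
Proof.
move=> [sM pM] [sN pN]; split; first by rewrite linearD/= sM sN.
by move=> x; rewrite mulmxDr mulmxDl mxE addr_ge0.
Qed.

Lemma psdmx_congr n m (M : 'M[R]_n) (G : 'M[R]_(n, m)) :
  psdmx M -> psdmx (G^T *m M *m G).
Proof.
move=> [sM pM]; split; first by rewrite !trmx_mul trmxK sM mulmxA.
by move=> x; have := pM (G *m x); rewrite trmx_mul !mulmxA.
Qed.

Lemma pdmxW n (M : 'M[R]_n) : pdmx M -> psdmx M.
Proof.
move=> [sM pM]; split => // x; have [->|/pM/ltW//] := eqVneq x 0.
by rewrite mulmx0 mxE.
Qed.

Lemma pdmxD_psd n (M N : 'M[R]_n) : pdmx M -> psdmx N -> pdmx (M + N).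
Proof.
move=> [sM pM] [sN pN]; split; first by rewrite linearD/= sM sN.
by move=> x x0; rewrite mulmxDr mulmxDl mxE ltr_wpDr// pM.
Qed.

(** A row vector in the kernel annihilates the quadratic form. *)
Lemma pdmx_unit n (M : 'M[R]_n) : pdmx M -> M \in unitmx.
Proof.
move=> [sM pM]; rewrite -row_free_unit -kermx_eq0; apply/rowV0P => v.
move=> /sub_kermxP vM; apply/eqP; apply: contraT => v0.
have := pM v^T; rewrite trmxK vM mul0mx mxE ltxx trmx_eq0 => h.
by have := h v0.
Qed.

Context {n m : nat}.
Variables (A : 'M[R]_n) (B : 'M[R]_(n, m)) (C : 'M[R]_n) (D : 'M[R]_(n, m)).
Variables (Q : 'M[R]_n) (Rw : 'M[R]_m).

(** It vanishes at the matrix of the quadratic cost of the linear feedback Theta. *)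
Definition feedback_cost (Theta : 'M[R]_(m, n)) (M : 'M[R]_n) : 'M[R]_n :=
  (A + B *m Theta)^T *m M + M *m (A + B *m Theta) +
  (C + D *m Theta)^T *m M *m (C + D *m Theta) + Q + Theta^T *m Rw *m Theta.

Local Notation weight := (riccati_weight D Rw).
Local Notation crossmx := (riccati_cross B C D).

(** Completing the square: Theta enters through Theta^T K + K^T Theta + Theta^T W Theta. *)
Lemma feedback_cost_square (Theta : 'M[R]_(m, n)) (M : 'M[R]_n) :
  M^T = M -> Rw^T = Rw -> weight M \in unitmx ->
  let G := Theta + invmx (weight M) *m crossmx M in
  feedback_cost Theta M = riccati A B C D Q Rw M + G^T *m weight M *m G.
Proof.
move=> sM sR uW /=.
have tD p q (X Y : 'M[R]_(p, q)) : (X + Y)^T = X^T + Y^T by exact: linearD.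
have sW : (weight M)^T = weight M.
  by rewrite /riccati_weight linearD/= !trmx_mul sM sR trmxK mulmxA.
have KT : (crossmx M)^T = M *m B + C^T *m M *m D.
  by rewrite /riccati_cross linearD/= !trmx_mul sM !trmxK mulmxA.
have -> : (Theta + invmx (weight M) *m crossmx M)^T *m weight M *m
    (Theta + invmx (weight M) *m crossmx M) =
    Theta^T *m weight M *m Theta + Theta^T *m crossmx M +
    (crossmx M)^T *m Theta + (crossmx M)^T *m invmx (weight M) *m crossmx M.
  rewrite tD trmx_mul trmx_inv sW mulmxDl mulmxKV//.
  have E : Theta^T *m weight M *m (invmx (weight M) *m crossmx M) =
    Theta^T *m crossmx M by rewrite -mulmxA mulKVmx.
  rewrite mulmxDr !mulmxDl E !mulmxA.
  by rewrite -!addrA; congr (_ + _); rewrite addrCA.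
rewrite /feedback_cost /riccati.
move: ((crossmx M)^T *m invmx _ *m crossmx M) => J.
rewrite KT !tD !trmx_mul /riccati_weight /riccati_cross.
rewrite !(mulmxDl, mulmxDr) !mulmxA.
by zmod_mx.
Qed.

End RiccatiAlgebra.

(** Subtract the completed squares at Pinf, where the cost vanishes, and at P, where it is
    positive semidefinite. *)
Lemma riccati_difference (R : realType) (n m : nat) (A : 'M[R]_n) (B : 'M[R]_(n, m))
    (C : 'M[R]_n) (D : 'M[R]_(n, m)) (Q : 'M[R]_n) (Rw : 'M[R]_m) (P Pinf : 'M[R]_n) :
  pdmx Rw -> psdmx P -> psdmx (riccati A B C D Q Rw P) ->
  Pinf^T = Pinf -> riccati_weight D Rw Pinf \in unitmx ->
  riccati A B C D Q Rw Pinf = 0 ->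
  let Theta := - (invmx (riccati_weight D Rw Pinf) *m riccati_cross B C D Pinf) in
  let Acl := A + B *m Theta in let Ccl := C + D *m Theta in
  exists2 S, psdmx S &
    Acl^T *m (Pinf - P) + (Pinf - P) *m Acl + Ccl^T *m (Pinf - P) *m Ccl = - S.
Proof.
move=> hR hP hRP sP uP eP Theta Acl Ccl; have [sPP _] := hP; have [sR _] := hR.
have pdW : pdmx (riccati_weight D Rw P).
  by apply: pdmxD_psd => //; exact: psdmx_congr.
exists (feedback_cost A B C D Q Rw Theta P).
  rewrite feedback_cost_square ?pdmx_unit//; apply: psdmxD => //.
  exact/psdmx_congr/pdmxW.
have : feedback_cost A B C D Q Rw Theta Pinf = 0.
  rewrite feedback_cost_square// eP add0r [X in X^T](_ : _ = 0) ?trmx0 ?mul0mx//.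
  by rewrite /Theta addNr.
rewrite /feedback_cost -/Acl -/Ccl => E.
rewrite -[LHS]subr0 -{}E !(mulmxDl, mulmxDr) !mulmxN !mulNmx.
by zmod_mx.
Qed.

(** * The Lyapunov equation of a stable system *)

Section RintegralSum.
Context {d : measure_display} {T : measurableType d} {R : realType}.
Variables (m : {measure set T -> \bar R}) (D : set T).
Hypothesis mD : measurable D.

Lemma Rintegral_sum (I : Type) (r : seq I) (f : I -> T -> R) :
  (forall i, m.-integrable D (EFin \o f i)) ->
  m.-integrable D (EFin \o (fun x => \sum_(i <- r) f i x)) /\
  \int[m]_(x in D) (\sum_(i <- r) f i x) = \sum_(i <- r) \int[m]_(x in D) f i x.
Proof.
move=> fi; elim: r => [|i r [IH1 IH2]].
  have -> : (fun x => \sum_(i <- [::]) f i x) = fun=> 0.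
    by apply/funext => x; rewrite big_nil.
  by rewrite big_nil Rintegral_cst// mul0r; split => //; exact: integrable0.
have -> : (fun x => \sum_(j <- i :: r) f j x) = fun x => f i x + \sum_(j <- r) f j x.
  by apply/funext => x; rewrite big_cons.
rewrite big_cons -IH2 RintegralD//; split => //.
exact: (integrableD mD (fi i) IH1).
Qed.

End RintegralSum.

(** Monotonicity straight from the definition as a supremum over simple functions; it applies to
    inner integrals whose dependence on the outer variable is not known to be
    measurable. *)
Lemma le_ge0_integral d (T : measurableType d) (R : realType)
    (m : {measure set T -> \bar R}) (f g : T -> \bar R) :
  (forall x, 0 <= f x)%E -> (forall x, f x <= g x)%E ->
  (\int[m]_x f x <= \int[m]_x g x)%E.
Proof.
move=> f0 fg; have g0 x : (0 <= g x)%E by exact: le_trans (fg x).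
rewrite !ge0_integralTE//; apply: ub_ereal_sup => _ [h hf <-].
apply: ereal_sup_ubound; exists h => // x; exact: le_trans (hf x) _.
Qed.

Section Lyapunov.
Context {R : realType} {d : measure_display} {Omega : measurableType d}.
Variables (P : probability Omega R) (F : R -> set (set Omega)).
Variables (W : R -> Omega -> R).
Hypotheses (hF : complete_filtration P F) (hW : brownian_motion P F W).
Notation mu := (@lebesgue_measure R).
Notation muP := (mu \x P)%E.
Notation cross T H H' := (ip muP (trunc T H) (trunc T H')).

Lemma trunc_lincomb T (I : finType) (c : I -> R) (H : I -> R -> Omega -> R) :
  trunc T (fun s w => \sum_j c j * H j s w) = fun z => \sum_j c j * trunc T (H j) z.
Proof.
apply/funext => z; rewrite /trunc mulr_suml; apply: eq_bigr => j _.
by rewrite mulrA.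
Qed.

Lemma ito_integrand_lincomb T (I : finType) (c : I -> R) (H : I -> R -> Omega -> R) :
  0 <= T -> (forall j, ito_integrand P F T (H j)) ->
  ito_integrand P F T (fun s w => \sum_j c j * H j s w).
Proof.
move=> T0 hH; split.
- apply: measurable_sum => j; apply: measurable_funM => //.
  exact: (ito_measurable (hH j)).
- move=> t t0.
  apply/(measurable_wrtP hF) => //; apply: measurable_sum => j.
  apply: measurable_funM => //.
  by apply/(measurable_wrtP hF) => //; exact: (ito_adapted (hH j)).
- have sH j : sqint muP (fun z => c j * trunc T (H j) z).
    by apply: sqintZ; exact: sqint_trunc (hH j).
  have [mS lS] := sqint_sum (index_enum I) sH.
  rewrite -(@integral_trunc _ _ _ P T (fun z => (\sum_j c j * trunc T (H j) z) ^+ 2)) in lS.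
  + apply: le_lt_trans lS; rewrite le_eqVlt; apply/orP; left; apply/eqP.
    apply: eq_integral => w _; apply: eq_integral => s sT.
    congr (_ ^+ 2)%:E; apply: eq_bigr => j _; rewrite /trunc /= indicE.
    by rewrite sT mulr1.
  + exact: measurable_funX.
  + by move=> z; rewrite sqr_ge0.
  + move=> s w sT; rewrite big1 ?expr0n// => j _.
    by rewrite /trunc/= indicE mem_setE in_itv/= (negbTE sT) !mulr0.
Qed.

Section Solution.
Variables (n : nat) (A C : 'M[R]_n) (x : 'cV[R]_n) (X : R -> Omega -> 'cV[R]_n).
Hypothesis hX : sde_solution P F W A C x X.

Let U (i : 'I_n) (s : R) (w : Omega) : R := X s w i 0.
Let lin (M : 'M[R]_n) (i : 'I_n) (s : R) (w : Omega) : R := (M *m X s w) i 0.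

Let linE M i : lin M i = fun s w => \sum_j M i j * U j s w.
Proof. by apply/funext => s; apply/funext => w; rewrite /lin mxE. Qed.

Let sqintU T i : 0 <= T -> sqint muP (trunc T (U i)).
Proof. by move=> T0; apply: sqint_trunc (sde_integrand hX i T0). Qed.

Let state_process i : ito_process P F W (x i 0) (lin A i) (lin C i) (U i).
Proof.
split => [T T0|T T0|t t0].
- rewrite linE; apply: ito_integrand_lincomb => // j; exact: (sde_integrand hX).
- exact: (sde_integrand hX).
- exact: (sde_equation hX i t0).
Qed.

Let sqint_lin M i t : 0 <= t -> sqint P (lin M i t).
Proof.
move=> t0; rewrite linE; apply: sqint_sum => j; apply: sqintZ.
exact: (sqint_state hF hW (state_process j)).
Qed.

Definition moment (t : R) : 'M[R]_n := \matrix_(i, j) ip P (U i t) (U j t).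
(** The time integral over [0, T] of the second moments. *)
Definition occupation (T : R) : 'M[R]_n := \matrix_(i, j) cross T (U i) (U j).

Let cross_lin T M N i j : 0 <= T ->
  cross T (lin M i) (lin N j) = (M *m occupation T *m N^T) i j.
Proof.
move=> T0; have sU k := sqintU k T0.
have sz (c : R) k : sqint muP (fun z => c * trunc T (U k) z) by apply: sqintZ.
rewrite !linE !trunc_lincomb ip_suml//; last exact: sqint_sum.
rewrite -mulmxA mxE; apply: eq_bigr => k _; rewrite ipZl//; last exact: sqint_sum.
congr (_ * _); rewrite ipC ip_suml// mxE; apply: eq_bigr => l _.
by rewrite ipZl// ipC !mxE mulrC.
Qed.

Let lin1 i : U i = lin 1%:M i.
Proof. by apply/funext => s; apply/funext => w; rewrite /lin mul1mx. Qed.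

(** The product rule in all pairs of coordinates, as one matrix equation. *)
Lemma moment_equation T : 0 <= T ->
  moment T = x *m x^T + (A *m occupation T + occupation T *m A^T +
             C *m occupation T *m C^T).
Proof.
move=> T0; apply/matrixP => i j; rewrite mxE.
rewrite (product_rule hF hW T0 (state_process i) (state_process j)); last 2 first.
- exact: sqint_lin.
- exact: sqint_lin.
rewrite [U i in X in _ + X + _]lin1 [U j in X in _ + X + _ + _]lin1 !cross_lin//.
rewrite trmx1 mulmx1 mul1mx !mxE big_ord1 !mxE; ring.
Qed.

(** The trace is the integral of the quadratic form of S along the truncated path. *)
Lemma occupation_psd (S : 'M[R]_n) T : 0 <= T -> psdmx S ->
  0 <= \tr (S *m occupation T).
Proof.
move=> T0 [_ pS].
have sS i : sqint muP (trunc T (lin S i)).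
  rewrite linE trunc_lincomb; apply: sqint_sum => j; apply: sqintZ; exact: sqintU.
rewrite (_ : \tr _ = \sum_i cross T (lin S i) (U i)); last first.
  apply: eq_bigr => i _; rewrite [X in _ = ip _ _ (trunc T X)]lin1 cross_lin//.
  by rewrite trmx1 mulmx1.
have [_ <-] := @Rintegral_sum _ _ _ muP setT measurableT _ (index_enum 'I_n)
  (fun i z => trunc T (lin S i) z * trunc T (U i) z)
  (fun i => sqint_integrableM (sS i) (sqintU i T0)).
apply: Rintegral_ge0 => z _.
rewrite (_ : \sum_i _ = ((X z.1 z.2)^T *m S *m X z.1 z.2) 0 0 * \1_`[0, T] z.1).
  by rewrite mulr_ge0.
rewrite -mulmxA mxE mulr_suml; apply: eq_bigr => i _.
rewrite [(_^T) _ _]mxE /trunc /lin /U indicE.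
by case: (_ \in _); rewrite ?mulr1 ?mulr0 ?mul0r// mulrC.
Qed.

Lemma occupation_le (K : R) T :
  (\int[P]_w \int[mu]_(s in `[0%R, +oo[) (\sum_i (X s w i 0) ^+ 2)%:E <= K%:E)%E ->
  0 <= T -> \tr (occupation T) <= K.
Proof.
move=> hK T0.
have [_ E] := @Rintegral_sum _ _ _ muP setT measurableT _ (index_enum 'I_n)
  (fun i z => trunc T (U i) z * trunc T (U i) z)
  (fun i => sqint_integrableM (sqintU i T0) (sqintU i T0)).
rewrite /mxtrace (eq_bigr (fun i => cross T (U i) (U i))); last by move=> i _; rewrite mxE.
rewrite /ip -E -lee_fin fineK; last first.
  have [iI _] := @Rintegral_sum _ _ _ muP setT measurableT _ (index_enum 'I_n)
    (fun i z => trunc T (U i) z * trunc T (U i) z)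
    (fun i => sqint_integrableM (sqintU i T0) (sqintU i T0)).
  exact: (integrable_fin_num measurableT iI).
have mU i : measurable_fun setT (trunc T (U i)) by case: (sqintU i T0).
rewrite -(@integral_trunc _ _ _ P T
  (fun z => \sum_i trunc T (U i) z * trunc T (U i) z)).
- apply: le_trans hK; apply: le_ge0_integral => w.
    by apply: integral_ge0 => s _; rewrite lee_fin sumr_ge0// => i _; rewrite -expr2 sqr_ge0.
  rewrite [leLHS]integral_mkcond [leRHS]integral_mkcond.
  apply: le_ge0_integral => s.
    rewrite patchE; case: ifP => // _; rewrite lee_fin sumr_ge0// => i _.
    by rewrite -expr2 sqr_ge0.
  rewrite !patchE !mem_setE !in_itv/= andbT.
  case: (boolP (0 <= s)) => s0 //=; case: ifP => sT; rewrite lee_fin.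
    apply: ler_sum => i _; rewrite /trunc/= indicE mem_setE in_itv/= s0 sT mulr1.
    by rewrite expr2.
  by rewrite sumr_ge0// => i _; rewrite sqr_ge0.
- by apply: measurable_sum => i; exact: measurable_funM.
- by move=> z; rewrite sumr_ge0// => i _; rewrite -expr2 sqr_ge0.
- move=> s w sT; rewrite big1// => i _.
  by rewrite /trunc/= indicE mem_setE in_itv/= (negbTE sT) !mulr0.
Qed.

Lemma occupation_ge (eta : R) T : 0 <= T ->
  (forall t, 0 <= t -> eta <= \tr (moment t)) -> eta * T <= \tr (occupation T).
Proof.
move=> T0 heta.
have [iI E] := @Rintegral_sum _ _ _ mu `[0, T]%classic (measurable_itv _) _
  (index_enum 'I_n) (fun i s => ip P (U i s) (U i s))
  (fun i => slices_integrable (sqintU i T0) (sqintU i T0)).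
have -> : \tr (occupation T) =
    \int[mu]_(s in `[0, T]) (\sum_i ip P (U i s) (U i s)).
  rewrite E; apply: eq_bigr => i _; rewrite mxE ip_slices//; exact: sqintU.
have -> : eta * T = \int[mu]_(s in `[0, T]) eta.
  rewrite Rintegral_cst//= lebesgue_measure_itv/= lte_fin.
  case: ltP => //= [_|T0']; first by rewrite subr0.
  by rewrite (le_anti (introT andP (conj T0 T0'))).
apply: le_Rintegral => //.
  apply/integrableP; split; first exact: measurable_cst.
  rewrite integral_cst//= lebesgue_measure_itv/=.
  by case: ifP => _; rewrite -?EFinB -?EFinM ?mule0 ltry.
move=> s; rewrite /= in_itv/= => /andP[s0 _]; apply: le_trans (heta s s0) _.
by rewrite le_eqVlt; apply/orP; left; apply/eqP; apply: eq_bigr => i _; rewrite mxE.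
Qed.

Lemma moment_bound (M : 'M[R]_n) t : 0 <= t ->
  `|\tr (M *m moment t)| <= (\sum_i \sum_j `|M i j|) * \tr (moment t).
Proof.
move=> t0; rewrite mulr_suml (le_trans (ler_norm_sum _ _ _))//.
apply: ler_sum => i _; rewrite mxE mulr_suml (le_trans (ler_norm_sum _ _ _))//.
apply: ler_sum => j _; rewrite normrM ler_wpM2l// mxE.
have sU k : sqint P (U k t) := sqint_state hF hW (state_process k) t0.
have le_tr k : ip P (U k t) (U k t) <= \tr (moment t).
  rewrite /mxtrace (bigD1 k)//= mxE lerDl sumr_ge0// => l _.
  by rewrite mxE ip_ge0.
have tr0 := le_trans (ip_ge0 P (U i t)) (le_tr i).
rewrite -(@ler_pXn2r _ 2) ?nnegrE// real_normK ?num_real//.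
apply: le_trans (ip_CS (sU j) (sU i)) _.
by rewrite expr2 ler_pM ?ip_ge0.
Qed.

End Solution.

(** By the moment equation the trace of Delta times the second moment matrix starts at
    x^T Delta x and can only decrease.  If it started below zero, the trace of the second
    moment matrix would stay above some eta > 0, and its time integral would grow like
    eta * T, against stability. *)
Theorem stable_lyapunov n (A C Delta S : 'M[R]_n) :
  L2_stable P F W A C -> Delta^T = Delta -> psdmx S ->
  A^T *m Delta + Delta *m A + C^T *m Delta *m C = - S -> psdmx Delta.
Proof.
move=> stab sD pS eqS; split => // x.
have [X hX intX] := stab x.
rewrite leNgt; apply/negP => neg.
set delta := (x^T *m Delta *m x) 0 0 in neg.
have decay T : 0 <= T -> \tr (Delta *m moment X T) <= delta.
  move=> T0; rewrite (moment_equation hX T0).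
  have := occupation_psd hX T0 pS.
  set G := occupation X T => h.
  rewrite mulmxDr mxtraceD (_ : \tr (Delta *m (x *m x^T)) = delta); last first.
    by rewrite mulmxA mxtrace_mulC mulmxA /mxtrace big_ord1.
  rewrite (_ : \tr (Delta *m _) = - \tr (S *m G)); first by rewrite gerDl oppr_le0.
  rewrite (_ : - \tr (S *m G) = \tr (- S *m G)); last by rewrite mulNmx raddfN.
  rewrite -eqS !mulmxDr !mulmxDl !mxtraceD [X in X + _ = _]addrC !mulmxA.
  congr (_ + _ + _); first by rewrite mxtrace_mulC mulmxA.
  by rewrite mxtrace_mulC !mulmxA.
pose c := \sum_i \sum_j `|Delta i j|.
have c_ge0 : 0 <= c by apply: sumr_ge0 => i _; apply: sumr_ge0.
have lower t : 0 <= t -> - delta <= c * \tr (moment X t).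
  move=> t0; apply: le_trans (moment_bound hX Delta t0).
  by rewrite -normrN (le_trans _ (ler_norm _))// lerN2 decay.
have c_gt0 : 0 < c.
  rewrite lt_neqAle c_ge0 andbT; apply/eqP => c0.
  by have := lower 0 (lexx 0); rewrite -c0 mul0r oppr_le0 leNgt neg.
pose eta := - delta / c.
have eta_gt0 : 0 < eta by rewrite divr_gt0// oppr_gt0.
have eta_le t : 0 <= t -> eta <= \tr (moment X t).
  by move=> t0; rewrite ler_pdivrMr// mulrC lower.
(* at time K / eta + 1 the integral of the trace would exceed K, the total *)
pose K := fine (\int[P]_w \int[mu]_(s in `[0%R, +oo[) (\sum_i (X s w i 0) ^+ 2)%:E)%E.
have intX_ge0 : (0 <= \int[P]_w \int[mu]_(s in `[0%R, +oo[)
    (\sum_i (X s w i 0) ^+ 2)%:E)%E.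
  apply: integral_ge0 => w _; apply: integral_ge0 => s _.
  by rewrite lee_fin sumr_ge0// => i _; rewrite sqr_ge0.
have K0 : 0 <= K by rewrite fine_ge0.
have T0 : 0 <= K / eta + 1 by rewrite addr_ge0// divr_ge0// ltW.
have hK : (\int[P]_w \int[mu]_(s in `[0%R, +oo[)
    (\sum_i (X s w i 0) ^+ 2)%:E <= K%:E)%E.
  by rewrite fineK// ge0_fin_numE.
have := le_trans (occupation_ge hX T0 eta_le) (occupation_le hX hK T0).
by rewrite mulrDr mulr1 mulrCA divff ?gt_eqF// mulr1 gerDl leNgt eta_gt0.
Qed.

End Lyapunov.

(** * Comparison with the stabilizing solution *)

Theorem lemma4p9 (R : realType) (d : measure_display) (Omega : measurableType d)
    (Pr : probability Omega R) (F : R -> set (set Omega)) (W : R -> Omega -> R)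
    (hF : complete_filtration Pr F) (hW : brownian_motion Pr F W)
    (n m : nat) (A : 'M[R]_n) (B : 'M[R]_(n, m))
    (C : 'M[R]_n) (D : 'M[R]_(n, m)) (Q : 'M[R]_n) (Rw : 'M[R]_m)
    (hQ : psdmx Q) (hR : pdmx Rw)
    (hstab : L2_stabilizable Pr F W A B C D)
    (Pinf : 'M[R]_n) (hPinf : static_stabilizing A B C D Q Rw Pr F W Pinf)
    (P : 'M[R]_n) (hP : psdmx P) (hRP : psdmx (riccati A B C D Q Rw P)) :
  loewner_le P Pinf.
Proof.
have [sPinf uPinf ePinf stab] := hPinf; have [sP _] := hP.
have [S pS eS] := riccati_difference hR hP hRP sPinf uPinf ePinf.
by apply: (stable_lyapunov hF hW stab _ pS eS); rewrite linearB/= sPinf sP.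
Qed.
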